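(* Let $d\ge2$ and $q\ge 2$ be integers, let $q=p_1\cdots p_r$ be the factorization of $q$ in prime powers, and suppose $p_\iota\ge d-1$ for all $\iota\in\{1,\dots,r\}$. Then $\mathrm{DL}_d(q)$ is a Cayley graph of the group $\Gamma_d(\mathbb F_q)$ of affine matrices $$\begin{pmatrix}(t+\ell_1)^{k_1}\cdots(t+\ell_{d-1})^{k_{d-1}}&P\\0&1\end{pmatrix},\qquad k_1,\dots,k_{d-1}\in\mathbb Z,\ P\in\mathcal R_d(\mathbb F_q),$$ where the ring $\mathbb F_q$, the elements $\ell_j\in\mathbb F_q$ and the ring $\mathcal R_d(\mathbb F_q)$ are as defined in the context.
   Context: In the factorization $q=p_1\cdots p_r$ the $p_\iota$ are prime powers (powers of pairwise distinct primes, not necessarily primes themselves). $\mathbb F_{p_\iota}$ is the field of order $p_\iota$, and $\mathbb F_q:=\mathbb F_{p_1}\times\dots\times\mathbb F_{p_r}$ with coordinatewise addition and multiplication. For each $\iota$ choose distinct elements $\ell_{\iota,1},\dots,\ell_{\iota,d-1}\in\mathbb F_{p_\iota}$ and set $\ell_j=(\ell_{1,j},\dots,\ell_{r,j})\in\mathbb F_q$, $j=1,\dots,d-1$. With an indeterminate $t$, $$\mathcal R_d(\mathbb F_q)=\mathbb F_q[(t+\ell_1)^{-1},\dots,(t+\ell_{d-1})^{-1},t]$$ is the ring of all polynomials over $\mathbb F_q$ in $(t+\ell_1)^{-1},\dots,(t+\ell_{d-1})^{-1},t$ (the localization of $\mathbb F_q[t]$ at $t+\ell_1,\dots,t+\ell_{d-1}$).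 $\mathbb T_q$ is the homogeneous tree in which every vertex has $q+1$ neighbours, with graph metric $d(\cdot,\cdot)$, a fixed origin $o$ and a fixed end $\omega$ (an end is a class of one-sided infinite geodesic rays, two rays being equivalent if their symmetric difference is finite). Let $x\curlywedge y$ be the maximal common ancestor of $x,y$, i.e. the first common vertex of the geodesic rays from $x$ and from $y$ that represent $\omega$. The Busemann function is $\mathfrak h(x)=d(x,x\curlywedge o)-d(o,x\curlywedge o)$. The graph $\mathrm{DL}_d(q)=\mathrm{DL}(q,\dots,q)$ ($d$ times) has vertex set $\{x_1\cdots x_d\in(\mathbb T_q)^d:\ \mathfrak h(x_1)+\dots+\mathfrak h(x_d)=0\}$, and $x_1\cdots x_d$, $y_1\cdots y_d$ are neighbours iff there are $i\ne j$ such that $x_i\sim y_i$, $x_j\sim y_j$ in $\mathbb T_q$ and $x_k=y_k$ for all $k\ne i,j$. A Cayley graph of a group $\Gamma$ is taken with respect to some finite generating set $S=S^{-1}$; it has vertex set $\Gamma$ and edges $[x,y]$ whenever $x^{-1}y\in S$. *)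

(* Defs.v *)
From HB Require Import structures.
(* Imported first: mpoly shadows ssrbool's [symmetric]. *)
From mathcomp Require Import mpoly.
From mathcomp Require Import all_boot all_order all_algebra.
From mathcomp Require Import finmap boolp classical_sets functions cardinality.

Set Implicit Arguments.
Unset Strict Implicit.
Unset Printing Implicit Defensive.

Import GRing.Theory.

Local Open Scope ring_scope.
Local Open Scope classical_set_scope.
Local Open Scope card_scope.

Section Trees.
Variables (T : choiceType) (e : rel T).

Definition is_walk (x y : T) (s : seq T) : Prop := path e x s /\ last x s = y.

Definition is_tree : Prop :=
  [/\ symmetric e, irreflexive e,
      forall x y, exists s, is_walk x y s
    & forall c : seq T, (2 < size c)%N -> ~ ucycle e c].

Definition homogeneous_tree (q : nat) : Prop :=
  is_tree /\ forall x, [set y | e x y] #= `I_q.+1.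

Definition is_distance (x y : T) (n : nat) : Prop :=
  (exists2 s, is_walk x y s & size s = n) /\
  (forall s, is_walk x y s -> (n <= size s)%N).

(* The default value 0 is only taken when x and y are not connected. *)
Definition gdist (x y : T) : nat := xget 0%N [set n | is_distance x y n].

Definition geodesic_ray (g : nat -> T) : Prop :=
  forall m n, gdist (g m) (g (m + n)%N) = n.

Definition ray_equiv (g h : nat -> T) : Prop :=
  finite_set (range g `+` range h).

Definition is_end (w : set (nat -> T)) : Prop :=
  exists2 g, geodesic_ray g & w = [set h | geodesic_ray h /\ ray_equiv g h].

Definition is_confluent (w : set (nat -> T)) (x y z : T) : Prop :=
  exists g h m n,
    [/\ w g /\ g 0%N = x, w h /\ h 0%N = y, g m = z /\ h n = z
      & forall i j, g i = h j -> (m <= i)%N /\ (n <= j)%N].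

(* The maximal common ancestor; the default value x is never taken when e is a
   tree and w is an end of it. *)
Definition confluent (w : set (nat -> T)) (x y : T) : T :=
  xget x [set z | is_confluent w x y z].

Definition busemann (w : set (nat -> T)) (o x : T) : int :=
  (gdist x (confluent w x o))%:Z - (gdist o (confluent w x o))%:Z.

Definition DL_vertex (d : nat) (w : set (nat -> T)) (o : T) : Type :=
  {x : {ffun 'I_d -> T} | \sum_(i < d) busemann w o (x i) == 0}.

Definition DL_adj (d : nat) (w : set (nat -> T)) (o : T)
    (x y : DL_vertex d w o) : Prop :=
  exists i j : 'I_d,
    [/\ i != j, e (val x i) (val y i), e (val x j) (val y j)
      & forall k, k != i -> k != j -> val x k = val y k].

End Trees.

Definition generates (G : groupType) (S : {fset G}) : Prop :=
  forall H : {pred G}, group_closed H -> {subset S <= H} -> forall x, x \in H.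

Definition is_Cayley_graph (V : Type) (adj : V -> V -> Prop) (G : groupType) :
    Prop :=
  exists S : {fset G},
    [/\ forall x, (x^-1 \in S)%g = (x \in S), generates S
      & exists2 f : G -> V, bijective f &
        forall x y, adj (f x) (f y) <-> (x^-1 * y \in S)%g].

(* The product of a nonempty finite family of commutative rings, with
   coordinatewise operations; nonempty, so that 1 != 0. *)
Section ProductRing.
Variables (r : nat) (K : 'I_r.+1 -> comUnitRingType).

Definition prod_ring : Type := {dffun forall i : 'I_r.+1, K i}.
HB.instance Definition _ := Choice.on prod_ring.

Definition prod_mk (f : forall i, K i) : prod_ring := [ffun i => f i].
Definition prod_at (x : prod_ring) (i : 'I_r.+1) : K i := x i.

Lemma prod_mkE f i : prod_at (prod_mk f) i = f i.
Proof. by rewrite /prod_at /prod_mk ffunE. Qed.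

Lemma prodP (x y : prod_ring) : (forall i, prod_at x i = prod_at y i) -> x = y.
Proof. by move=> exy; apply/ffunP => i; exact: exy. Qed.

Definition prod_zero := prod_mk (fun=> 0).
Definition prod_one := prod_mk (fun=> 1).
Definition prod_opp x := prod_mk (fun i => - prod_at x i).
Definition prod_add x y := prod_mk (fun i => prod_at x i + prod_at y i).
Definition prod_mul x y := prod_mk (fun i => prod_at x i * prod_at y i).

Fact prod_addA : associative prod_add.
Proof. by move=> x y z; apply: prodP => i; rewrite !prod_mkE addrA. Qed.
Fact prod_addC : commutative prod_add.
Proof. by move=> x y; apply: prodP => i; rewrite !prod_mkE addrC. Qed.
Fact prod_add0 : left_id prod_zero prod_add.
Proof. by move=> x; apply: prodP => i; rewrite !prod_mkE add0r. Qed.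
Fact prod_addN : left_inverse prod_zero prod_opp prod_add.
Proof. by move=> x; apply: prodP => i; rewrite !prod_mkE addNr. Qed.

HB.instance Definition _ := GRing.isZmodule.Build prod_ring
  prod_addA prod_addC prod_add0 prod_addN.

Fact prod_mulA : associative prod_mul.
Proof. by move=> x y z; apply: prodP => i; rewrite !prod_mkE mulrA. Qed.
Fact prod_mulC : commutative prod_mul.
Proof. by move=> x y; apply: prodP => i; rewrite !prod_mkE mulrC. Qed.
Fact prod_mul1 : left_id prod_one prod_mul.
Proof. by move=> x; apply: prodP => i; rewrite !prod_mkE mul1r. Qed.
Fact prod_mulD : left_distributive prod_mul prod_add.
Proof. by move=> x y z; apply: prodP => i; rewrite !prod_mkE mulrDl. Qed.
Fact prod_one_neq0 : prod_one != 0 :> prod_ring.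
Proof.
apply/eqP => /(congr1 (fun x => prod_at x ord0)) /eqP.
by rewrite !prod_mkE oner_eq0.
Qed.

HB.instance Definition _ := GRing.Zmodule_isComNzRing.Build prod_ring
  prod_mulA prod_mulC prod_mul1 prod_mulD prod_one_neq0.

Definition prod_unit : {pred prod_ring} :=
  [pred x | [forall i, prod_at x i \is a GRing.unit]].
Definition prod_inv (x : prod_ring) : prod_ring :=
  if x \in prod_unit then prod_mk (fun i => (prod_at x i)^-1) else x.

Fact prod_mulV : {in prod_unit, left_inverse 1 prod_inv *%R}.
Proof.
move=> x ux; rewrite /prod_inv ux; apply: prodP => i.
by rewrite !prod_mkE mulVr //; exact: (forallP ux i).
Qed.
Fact prod_unitP (x y : prod_ring) : y * x = 1 -> x \in prod_unit.
Proof.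
move=> yx1; apply/forallP => i; apply/unitrP; exists (prod_at y i).
have := congr1 (fun z => prod_at z i) yx1; rewrite !prod_mkE => yx1i.
by split; last rewrite mulrC.
Qed.
Fact prod_inv_out : {in [predC prod_unit], prod_inv =1 id}.
Proof. by move=> x nux; rewrite /prod_inv (negbTE nux). Qed.

HB.instance Definition _ := GRing.ComNzRing_hasMulInverse.Build prod_ring
  prod_mulV prod_unitP prod_inv_out.

End ProductRing.

Section AffineGroup.
Variables (r n : nat) (F : 'I_r.+1 -> finFieldType).
Variable ell : forall i : 'I_r.+1, 'I_n -> F i.

Definition Fq := prod_ring (fun i => F i).

(* The ring of total fractions of F_q[t] = F_{p_1}[t] x ... x F_{p_r}[t]; it
   contains F_q[t], and R_d(F_q) is realized as a subring of it. *)
Definition Fqt := prod_ring (fun i => {fraction {poly F i}}).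

Definition constt (c : Fq) : Fqt :=
  prod_mk (fun i => FracField.tofrac (prod_at c i)%:P).

Definition tvar : Fqt := prod_mk (fun i => FracField.tofrac 'X).

Definition ellq (j : 'I_n) : Fq := prod_mk (fun i => ell i j).

Definition t_plus_ell (j : 'I_n) : Fqt := tvar + constt (ellq j).

(* The arguments (t + l_1)^-1, ..., (t + l_{d-1})^-1, t, where n = d - 1. *)
Definition Rd_var (k : 'I_n.+1) : Fqt :=
  if unlift ord_max k is Some j then (t_plus_ell j)^-1 else tvar.

Definition Rd (P : Fqt) : Prop :=
  exists p : {mpoly Fq[n.+1]}, P = mmap constt Rd_var p.

Definition affine_mx (a b : Fqt) : 'M[Fqt]_(1 + 1) :=
  block_mx a%:M b%:M 0 1%:M.

Definition is_Gamma (A : 'M[Fqt]_(1 + 1)) : Prop :=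
  exists k : 'I_n -> int, exists2 P, Rd P &
    A = affine_mx (\prod_j t_plus_ell j ^ k j) P.

Definition Gamma : Type := {A : 'M[Fqt]_(1 + 1) | `[< is_Gamma A >]}.
HB.instance Definition _ := Choice.on Gamma.

Lemma t_plus_ell_unit j : t_plus_ell j \is a GRing.unit.
Proof.
apply/forallP => i; rewrite unitfE /t_plus_ell !prod_mkE -rmorphD /=.
by rewrite tofrac_eq0 -size_poly_eq0 size_XaddC.
Qed.

Lemma constt_is_zmod_morphism : zmod_morphism constt.
Proof. by move=> x y; apply: prodP => i; rewrite !prod_mkE !rmorphB. Qed.
Lemma constt_is_monoid_morphism : monoid_morphism constt.
Proof.
split; first by apply: prodP => i; rewrite !prod_mkE !rmorph1.
by move=> x y; apply: prodP => i; rewrite !prod_mkE !rmorphM.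
Qed.
HB.instance Definition _ :=
  GRing.isZmodMorphism.Build Fq Fqt constt constt_is_zmod_morphism.
HB.instance Definition _ :=
  GRing.isMonoidMorphism.Build Fq Fqt constt constt_is_monoid_morphism.

Lemma RdN P : Rd P -> Rd (- P).
Proof. by move=> [p ->]; exists (- p); rewrite rmorphN. Qed.
Lemma RdD P Q : Rd P -> Rd Q -> Rd (P + Q).
Proof. by move=> [p ->] [q ->]; exists (p + q); rewrite rmorphD. Qed.
Lemma RdM P Q : Rd P -> Rd Q -> Rd (P * Q).
Proof. by move=> [p ->] [q ->]; exists (p * q); rewrite rmorphM. Qed.
Lemma Rd_const c : Rd (constt c).
Proof. by exists (c%:MP); rewrite mmapC. Qed.
Lemma Rd0 : Rd 0. Proof. by rewrite -(rmorph0 constt); exact: Rd_const. Qed.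
Lemma Rd1 : Rd 1. Proof. by rewrite -(rmorph1 constt); exact: Rd_const. Qed.
Lemma RdX P m : Rd P -> Rd (P ^+ m).
Proof.
move=> RP; elim: m => [|m IHm]; first by rewrite expr0; exact: Rd1.
by rewrite exprS; exact: RdM.
Qed.

Lemma Rd_vars k : Rd (Rd_var k).
Proof.
by exists ('X_k); rewrite mmapX mmap1U.
Qed.

Lemma Rd_t : Rd tvar.
Proof. by have := Rd_vars ord_max; rewrite /Rd_var unlift_none. Qed.

Lemma Rd_t_plus_ellV j : Rd (t_plus_ell j)^-1.
Proof. by have := Rd_vars (lift ord_max j); rewrite /Rd_var liftK. Qed.

Lemma Rd_scale k : Rd (\prod_j t_plus_ell j ^ k j).
Proof.
apply: (big_ind Rd Rd1 RdM) => j _; case: (k j) => m.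
  by apply: RdX; apply: RdD; [exact: Rd_t | exact: Rd_const].
by rewrite NegzE -exprnN -exprVn; apply: RdX; exact: Rd_t_plus_ellV.
Qed.

Lemma affine_mxM a b a' b' :
  affine_mx a b *m affine_mx a' b' = affine_mx (a * a') (a * b' + b).
Proof.
rewrite /affine_mx mulmx_block !mulmx0 !mul0mx !mulmx1 !add0r !addr0.
by rewrite -!scalar_mxM raddfD.
Qed.

Lemma affine_mx1 : affine_mx 1 0 = 1%:M.
Proof. by rewrite /affine_mx raddf0 -scalar_mx_block. Qed.

Lemma scale_unit (k : 'I_n -> int) :
  \prod_j t_plus_ell j ^ k j \is a GRing.unit.
Proof. by apply: rpred_prod => j _; rewrite unitrXz // t_plus_ell_unit. Qed.

Lemma scaleD (k k' : 'I_n -> int) :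
  \prod_j t_plus_ell j ^ k j * \prod_j t_plus_ell j ^ k' j =
  \prod_j t_plus_ell j ^ (k j + k' j).
Proof.
rewrite -big_split; apply: eq_bigr => j _.
by rewrite exprzDr // t_plus_ell_unit.
Qed.

Lemma scaleV (k : 'I_n -> int) :
  \prod_j t_plus_ell j ^ (- k j) * \prod_j t_plus_ell j ^ k j = 1.
Proof.
by rewrite scaleD big1 // => j _; rewrite addNr expr0z.
Qed.

Fact is_Gamma1 : is_Gamma 1%:M.
Proof.
exists (fun=> 0), 0; first exact: Rd0.
by rewrite big1 ?affine_mx1 // => j _; rewrite expr0z.
Qed.

Fact is_GammaM A B : is_Gamma A -> is_Gamma B -> is_Gamma (A *m B).
Proof.
move=> [k [P RP ->]] [k' [P' RP' ->]]; rewrite affine_mxM scaleD.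
exists (fun j => k j + k' j), (\prod_j t_plus_ell j ^ k j * P' + P) => //.
by apply: RdD => //; apply: RdM => //; exact: Rd_scale.
Qed.

Fact is_GammaV A : is_Gamma A ->
  is_Gamma (invmx A) /\ A \in unitmx.
Proof.
move=> [k [P RP ->]]; set a := \prod_j _.
set a' := \prod_j t_plus_ell j ^ (- k j).
have a'a : a' * a = 1 by exact: scaleV.
have BA : affine_mx a' (- (a' * P)) *m affine_mx a P = 1%:M.
  by rewrite affine_mxM a'a subrr affine_mx1.
have [_ uA] := mulmx1_unit BA; split=> //.
have -> : invmx (affine_mx a P) = affine_mx a' (- (a' * P)).
  by rewrite -[LHS]mul1mx -BA mulmxK.
exists (fun j => - k j), (- (a' * P)) => //.
by apply: RdN; apply: RdM => //; exact: Rd_scale.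
Qed.

Definition Gamma_one : Gamma := exist _ 1%:M (asboolT is_Gamma1).
Definition Gamma_mul (x y : Gamma) : Gamma :=
  exist _ (val x *m val y)
    (asboolT (is_GammaM (asboolW (valP x)) (asboolW (valP y)))).
Definition Gamma_inv (x : Gamma) : Gamma :=
  exist _ (invmx (val x))
    (asboolT (is_GammaV (asboolW (valP x))).1).

Fact Gamma_mulA : associative Gamma_mul.
Proof. by move=> x y z; apply: val_inj; rewrite /= mulmxA. Qed.
Fact Gamma_mul1 : left_id Gamma_one Gamma_mul.
Proof. by move=> x; apply: val_inj; rewrite /= mul1mx. Qed.
Fact Gamma_1mul : right_id Gamma_one Gamma_mul.
Proof. by move=> x; apply: val_inj; rewrite /= mulmx1. Qed.
Fact Gamma_mulV : left_inverse Gamma_one Gamma_inv Gamma_mul.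
Proof.
move=> x; apply: val_inj; rewrite /= mulVmx //.
exact: (is_GammaV (asboolW (valP x))).2.
Qed.
Fact Gamma_Vmul : right_inverse Gamma_one Gamma_inv Gamma_mul.
Proof.
move=> x; apply: val_inj; rewrite /= mulmxV //.
exact: (is_GammaV (asboolW (valP x))).2.
Qed.

HB.instance Definition _ := isGroup.Build Gamma
  Gamma_mulA Gamma_mul1 Gamma_1mul Gamma_mulV Gamma_Vmul.

End AffineGroup.

(* Main.v *)
From mathcomp Require Import mpoly.
Require Import Defs.
From mathcomp Require Import all_boot all_order all_algebra.
From mathcomp Require Import finmap boolp classical_sets functions cardinality.
From mathcomp Require Import zify ring.

Set Implicit Arguments.
Unset Strict Implicit.
Unset Printing Implicit Defensive.

Import Order.TTheory GRing.Theory Num.Theory.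

Local Open Scope ring_scope.

(** The group acts simply transitively on the vertices of a horocyclic product
    of trees, one for each place of F_q(t) at which the elements of R_d may have
    a pole: the places t = -l_j, and infinity.

    For a place k let V_k be the set of functions regular at k (at infinity:
    those that vanish there), let u_k be a unit of R_d with a simple pole at k
    (namely (t + l_j)^-1, or t + l_1 at infinity), and filter R_d by the balls
    B_k(m), the x with u_k^m x in V_k. Successive quotients of the filtration
    are copies of F_q ([local_residue], [local_residue_unique]), so the cosets x
    + B_k(m), with x + B_k(m-1) as the parent of x + B_k(m), form a tree in
    which every vertex has one parent and q children. A homogeneous tree of
    degree q + 1 with a chosen end has the same structure: the parent of a
    vertex is its neighbour towards the end, and the Busemann function is the
    level ([end_horocyclic]). Expanding elements of R_d into digits identifies
    the two trees, levels included ([filtration_labels]).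

    An affine map x |-> a x + P with a = prod_j (t + l_j)^(k_j) shifts the level
    by k_j in the tree of t = -l_j and by -(k_1 + ... + k_(d-1)) in the tree at
    infinity ([filtration_scale]). The sum of the shifts is 0, so the group
    element is sent to the vertex of DL_d whose k-th component is the coset of P
    at the level of its k-th shift. That this is a bijection is the statement
    that, once the levels are fixed with sum 0, R_d is in bijection with the
    product of its quotients by the balls: an element of R_d regular at all
    finite places is a polynomial, and a polynomial vanishing at infinity is 0
    ([Rd_local_eq0]); conversely partial fractions prescribe the polar parts at
    all places independently ([strong_approximation]). Distinctness of the l_j
    enters in the latter.

    Left translation preserves adjacency ([realize_adj]), so DL_d is the Cayley
    graph for the set of neighbours of the identity. These are given by a = (t +
    l_i)/(t + l_j) and P = c/(t + l_j), with c in F_q and i, j two different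
    places, where the factor of the place at infinity is replaced by 1; the
    elements with a = t + l_j and P = c already generate the group
    ([steps_generate]). *)

(** * Distances in trees *)

Section TreeMetric.
Variables (T : choiceType) (e : rel T).
Hypothesis tree_e : is_tree e.
Local Notation dist := (gdist e).

Lemma tree_sym : symmetric e. Proof. by case: tree_e. Qed.
Lemma tree_irr : irreflexive e. Proof. by case: tree_e. Qed.

(** A longer simple path would close up to a cycle. *)
Lemma edge_simple_path x y s :
  e x y -> path e x s -> last x s = y -> uniq (x :: s) -> s = [:: y].
Proof.
case: s => [|z [|z' s]] exy ps ls us.
- by move: exy; rewrite -ls tree_irr.
- by rewrite -ls.
- case: tree_e => _ _ _ /(_ (x :: z :: z' :: s) isT) [].
  by rewrite /ucycle us andbT (cycle_path x) /= in ls *; rewrite ls tree_sym exy.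
Qed.

Lemma neighbour_on_simple_path x y s :
  e x y -> path e x s -> uniq (x :: s) -> y \in s -> exists s', s = y :: s'.
Proof.
move=> exy ps us ys; case/splitPr: ys ps us => s1 s2.
rewrite -cat_rcons -cat_cons cat_uniq cat_path => /andP[ps1 _] /and3P[us1 _ _].
have := edge_simple_path exy ps1; rewrite last_rcons => /(_ erefl us1) ->.
by exists s2.
Qed.

Lemma simple_path_unique x s s' :
  path e x s -> path e x s' -> uniq (x :: s) -> uniq (x :: s') ->
  last x s = last x s' -> s = s'.
Proof.
elim: s x s' => [|y s IHs] x [|y' s'] ps ps' us us' ls //.
- by case/andP: us' => /negP[]; rewrite /= in ls; rewrite ls mem_last.
- by case/andP: us => /negP[]; rewrite /= in ls; rewrite -ls mem_last.
case/andP: (ps) => exy psy; case/andP: (us) => xs usy.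
have [ys'|ys'] := boolP (y \in y' :: s').
  have [s1 Es'] := neighbour_on_simple_path exy ps' us' ys'.
  case: Es' ps' us' ls => -> -> /andP[_ ps1] /andP[_ us1] ls.
  by rewrite (IHs y s1).
(* Otherwise y, x, y' :: s' is a simple path from y, so s passes through x. *)
have yx : y != x by apply: contraNneq xs => <-; exact: mem_head.
have sE : s = x :: y' :: s'.
  apply: (IHs y) => //; first by rewrite [path _ _ _]/= tree_sym exy.
  by rewrite [uniq _]cons_uniq us' andbT inE negb_or yx.
by move: xs; rewrite sE !inE eqxx orbT.
Qed.

Lemma shorten_walk x s : path e x s ->
  exists s', [/\ path e x s', last x s' = last x s, uniq (x :: s'),
                 {subset s' <= s} & (size s' <= size s)%N].
Proof.
case/shortenP => s' ps' us' sub; exists s'; split=> //.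
by case/andP: us' => _ us'; exact: uniq_leq_size.
Qed.

Lemma gdist_simple x s : path e x s -> uniq (x :: s) ->
  dist x (last x s) = size s.
Proof.
move=> ps us; have ds : is_distance e x (last x s) (size s).
  split=> [|s1 [ps1 ls1]]; first by exists s.
  have [s2 [ps2 ls2 us2 _ le21]] := shorten_walk ps1.
  by rewrite (simple_path_unique ps ps2 us us2) // ls2 ls1.
apply/eqP; rewrite eqn_leq /gdist.
case: xgetP => [n _ [[s1 w1 <-] min_s1]|/(_ _ ds)//].
by rewrite min_s1 // ds.2.
Qed.

Lemma gdist_simpleP x y : exists s,
  [/\ path e x s, last x s = y, uniq (x :: s) & dist x y = size s].
Proof.
case: tree_e => _ _ /(_ x y) [s1 [ps1 <-]] _.
have [s [ps ls us _ _]] := shorten_walk ps1.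
by exists s; split=> //; rewrite -ls gdist_simple.
Qed.

Lemma gdist_le_walk x s : path e x s -> (dist x (last x s) <= size s)%N.
Proof.
by move=> /shorten_walk[s' [ps' <- us' _ le]]; rewrite gdist_simple.
Qed.

Lemma shortest_walk_simple x s : path e x s -> size s = dist x (last x s) ->
  uniq (x :: s).
Proof.
move=> ps; have [s' [ps' <- us' sub le]] := shorten_walk ps.
rewrite gdist_simple // => ss'; rewrite (@leq_size_uniq _ (x :: s')) //=.
  by move=> z; rewrite !inE => /orP[->//|/sub ->]; rewrite orbT.
by rewrite ltnS ss'.
Qed.

Lemma gdistxx x : dist x x = 0%N.
Proof. exact: (@gdist_simple x [::]). Qed.

Lemma gdist_eq0 x y : dist x y = 0%N -> x = y.
Proof. by have [[|z s] [_ <- _ ->]] := gdist_simpleP x y. Qed.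

Lemma gdist_sym x y : dist x y = dist y x.
Proof.
suff le u v : (dist v u <= dist u v)%N by apply/eqP; rewrite eqn_leq !le.
move: u v => {}x {}y; have [s [ps <- _ ->]] := gdist_simpleP x y.
rewrite -[leqRHS](size_belast x) -size_rev.
case: (lastP s) ps => [|s' z] ps; first by rewrite gdistxx.
have psr : path e (last x (rcons s' z)) (rev (belast x (rcons s' z))).
  by rewrite rev_path (eq_path (e' := e)) // => a b; exact: tree_sym.
have := gdist_le_walk psr.
by rewrite last_rcons belast_rcons rev_cons last_rcons.
Qed.

Lemma gdist_triangle y x z : (dist x z <= dist x y + dist y z)%N.
Proof.
have [s [ps ls _ ->]] := gdist_simpleP x y.
have [s' [ps' <- _ ->]] := gdist_simpleP y z.
by rewrite -size_cat -ls -last_cat gdist_le_walk // cat_path ps ls.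
Qed.

Lemma gdist_edge x y : e x y -> dist x y = 1%N.
Proof.
move=> exy; apply: (@gdist_simple x [:: y]); rewrite /= ?exy // inE andbT.
by apply: contraTneq exy => ->; rewrite tree_irr.
Qed.

Lemma gdist1_edge x y : dist x y = 1%N -> e x y.
Proof.
by have [[|z [|z' s]] [/= + <- _ ->]] := gdist_simpleP x y => // /andP[].
Qed.

Lemma closer_neighbour_exists x z : x != z ->
  exists2 y, e x y & dist x z = (dist y z).+1.
Proof.
have [[|y s] [ps <- us ->]] := gdist_simpleP x z; first by rewrite eqxx.
by case/andP: ps us => exy ps /andP[_ us]; exists y; rewrite //= gdist_simple.
Qed.

Lemma closer_neighbour_unique z x y y' : e x y -> e x y' ->
  dist x z = (dist y z).+1 -> dist x z = (dist y' z).+1 -> y = y'.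
Proof.
have [s [ps ls us ->]] := gdist_simpleP y z.
have [s' [ps' ls' us' ->]] := gdist_simpleP y' z.
move=> exy exy' dxz dxz'.
suff: y :: s = y' :: s' by case.
by apply: (@simple_path_unique x); rewrite /= ?exy ?exy' ?ls ?ls' //;
  apply: shortest_walk_simple; rewrite /= ?exy ?exy' ?ls ?ls' ?dxz // -dxz'.
Qed.

(** Either y is on the simple path from x to z or x is on the one from y to
    z. *)
Lemma gdist_neighbour z x y : e x y ->
  dist x z = (dist y z).+1 \/ dist y z = (dist x z).+1.
Proof.
move=> exy; have [s [ps <- us dyz]] := gdist_simpleP y z.
have [xs|xs] := boolP (x \in y :: s); last first.
  by left; rewrite dyz -[last y s]/(last x (y :: s)) gdist_simple //= ?exy ?xs.
right; rewrite dyz; have yx : e y x by rewrite tree_sym.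
have {}xs : x \in s.
  move: xs; rewrite inE => /predU1P[xy|//].
  by move: exy; rewrite xy tree_irr.
have [s' Es] := neighbour_on_simple_path yx ps us xs.
rewrite Es in ps us *; case/andP: ps us => _ ps /andP[_ us].
by rewrite /= gdist_simple.
Qed.

End TreeMetric.
(** * The parent function and the Busemann function of a ray *)

Section RayParent.
Variables (T : choiceType) (e : rel T).
Hypothesis tree_e : is_tree e.
Local Notation dist := (gdist e).
Variable g : nat -> T.
Hypothesis ray_g : geodesic_ray e g.

Lemma ray_edge (h : nat -> T) n : geodesic_ray e h -> e (h n) (h n.+1).
Proof. by move=> ray_h; apply: (gdist1_edge tree_e); rewrite -addn1 ray_h. Qed.

Lemma ray_inj (h : nat -> T) : geodesic_ray e h -> injective h.
Proof.
move=> ray_h m n; wlog /subnKC <- : m n / (m <= n)%N => [le_inj hmn|].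
  by case/orP: (leq_total m n) => /le_inj; [exact | move/(_ (esym hmn))].
move=> hmn; have := ray_h m (n - m)%N; rewrite -hmn gdistxx // => <-.
by rewrite addn0.
Qed.

(** The numbers d(x, g n) + d(x, g 0) - n are natural numbers and do not
    increase with n, hence are eventually constant. *)
Lemma busemann_limit x :
  exists c : int, exists N, forall n, (N <= n)%N -> (dist x (g n))%:Z = c + n%:Z.
Proof.
pose slack n := (dist x (g n) + dist x (g 0%N) - n)%N.
have slackE n : (slack n + n = dist x (g n) + dist x (g 0%N))%N.
  rewrite subnK //; have := gdist_triangle tree_e x (g 0%N) (g n).
  have := ray_g 0%N n; rewrite add0n => ->; rewrite (gdist_sym tree_e (g 0%N)); lia.
have decr n : (slack n.+1 <= slack n)%N.
  have := gdist_triangle tree_e (g n) x (g n.+1).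
  rewrite (gdist_edge tree_e (ray_edge n ray_g)).
  by have := slackE n; have := slackE n.+1; lia.
have ex : exists s, `[< exists N, slack N = s >].
  by exists (slack 0%N); apply/asboolP; exists 0%N.
case: (ex_minnP ex) => s /asboolP[N sN] min_s.
exists (s%:Z - (dist x (g 0%N))%:Z), N => n le_Nn.
have : slack n = s.
  apply/eqP; rewrite eqn_leq min_s ?andbT; last by apply/asboolP; exists n.
  rewrite -(subnK le_Nn); elim: (n - N)%N => [|k IHk]; first by rewrite add0n sN.
  by rewrite addSn (leq_trans (decr _)).
by have := slackE n; lia.
Qed.

Definition ray_busemann x : int := projT1 (cid (busemann_limit x)).
Local Notation b := ray_busemann.

Lemma ray_busemannP x :
  exists N, forall n, (N <= n)%N -> (dist x (g n))%:Z = b x + n%:Z.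
Proof. exact: projT2 (cid (busemann_limit x)). Qed.

(** The parent is characterized as the neighbour through which x escapes along
    g. *)
Definition escapes_via x y :=
  exists N, forall n, (N <= n)%N -> dist x (g n) = (dist y (g n)).+1.

(** Once d(x, g m) grows by 1 at each step, a neighbour y cannot pass from being
    closer to being farther, since d(y, g m) would have to grow by 3. *)
Lemma closer_stays_closer x y n :
  (forall m, (n <= m)%N -> dist x (g m.+1) = (dist x (g m)).+1) ->
  dist x (g n) = (dist y (g n)).+1 -> e x y ->
  forall m, (n <= m)%N -> dist x (g m) = (dist y (g m)).+1.
Proof.
move=> far dn exy m /subnKC <-; elim: (m - n)%N => [|k IHk].
  by rewrite addn0.
rewrite addnS; case: (gdist_neighbour tree_e (g (n + k).+1) exy) => // dy.
have := gdist_triangle tree_e (g (n + k)) y (g (n + k).+1).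
rewrite (gdist_edge tree_e (ray_edge _ ray_g)) dy far ?leq_addr // IHk; lia.
Qed.

Lemma parent_exists x : exists y, e x y /\ escapes_via x y.
Proof.
have [N dN] := ray_busemannP x.
pose n := (N + dist x (g 0%N)).+1.
have [|y exy dy] := @closer_neighbour_exists _ _ tree_e x (g n).
  apply/eqP => xgn; have := ray_g 0%N n; rewrite add0n -xgn (gdist_sym tree_e).
  rewrite /n; lia.
exists y; split=> //; exists n; apply: closer_stays_closer => // m le_nm.
have := dN m; have := dN m.+1; rewrite /n in le_nm; lia.
Qed.

Definition parent x : T := projT1 (cid (parent_exists x)).

Lemma parent_edge x : e x (parent x).
Proof. exact: (projT2 (cid (parent_exists x))).1. Qed.

Lemma parent_escapes x : escapes_via x (parent x).
Proof. exact: (projT2 (cid (parent_exists x))).2. Qed.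

Lemma parent_unique x y : e x y -> escapes_via x y -> y = parent x.
Proof.
move=> exy [N dN]; have [N' dN'] := parent_escapes x.
apply: (closer_neighbour_unique tree_e (z := g (N + N')) exy (parent_edge x)).
  by apply: dN; exact: leq_addr.
by apply: dN'; exact: leq_addl.
Qed.

Lemma edge_parent x y : e x y <-> y = parent x \/ x = parent y.
Proof.
split=> [exy|[->|->]]; last 2 first.
- exact: parent_edge.
- by rewrite (tree_sym tree_e) parent_edge.
have [Nx dNx] := parent_escapes x; have [Ny dNy] := parent_escapes y.
have le1 := leq_addr Ny Nx; have le2 := leq_addl Nx Ny.
case: (gdist_neighbour tree_e (g (Nx + Ny)) exy) => dxy; [left|right].
  by apply: (closer_neighbour_unique tree_e exy (parent_edge x) dxy); exact: dNx.
have eyx : e y x by rewrite (tree_sym tree_e).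
by apply: (closer_neighbour_unique tree_e eyx (parent_edge y) dxy); exact: dNy.
Qed.

Lemma busemann_parent x : b (parent x) = b x - 1.
Proof.
have [N0 d0] := parent_escapes x.
have [N1 d1] := ray_busemannP x; have [N2 d2] := ray_busemannP (parent x).
pose n := (N0 + N1 + N2)%N.
have := d0 n; have := d1 n; have := d2 n; rewrite /n; lia.
Qed.

Lemma busemann_iter_parent n x : b (iter n parent x) = b x - n%:Z.
Proof. by elim: n => [|n IHn] /=; rewrite ?busemann_parent ?IHn; lia. Qed.

Lemma busemann_lipschitz x y : b x - b y <= (dist x y)%:Z.
Proof.
have [N1 d1] := ray_busemannP x; have [N2 d2] := ray_busemannP y.
have := d1 (N1 + N2)%N; have := d2 (N1 + N2)%N.
by have := gdist_triangle tree_e y x (g (N1 + N2)); lia.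
Qed.

(** Climbing from x decreases the distance to every far point g n by 1 at each
    step. *)
Lemma iter_parent_reaches_ray x :
  exists N, forall n, (N <= n)%N -> exists k, iter k parent x = g n.
Proof.
suff reach k n y : dist y (g n) = k ->
    (forall m, (n <= m)%N -> dist y (g m.+1) = (dist y (g m)).+1) ->
    iter k parent y = g n.
  have [N dN] := ray_busemannP x; exists N => n le_Nn.
  exists (dist x (g n)); apply: reach => // m le_nm.
  have := dN m; have := dN m.+1; lia.
elim: k n y => [|k IHk] n y; first by move/(gdist_eq0 tree_e).
move=> dk far; have [|z eyz dz] := @closer_neighbour_exists _ _ tree_e y (g n).
  by apply: contra_eq_neq dk => ->; rewrite (gdistxx tree_e).
have closer := closer_stays_closer far dz eyz.
rewrite iterSr -(parent_unique eyz); last by exists n.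
apply: IHk => [|m le_nm]; first by lia.
have := far m le_nm; have := closer m le_nm; have := closer m.+1; lia.
Qed.

Lemma common_ancestor x y : exists m n, iter m parent x = iter n parent y.
Proof.
have [N1 r1] := iter_parent_reaches_ray x.
have [N2 r2] := iter_parent_reaches_ray y.
have [m xm] := r1 _ (leq_addr N2 N1); have [n yn] := r2 _ (leq_addl N1 N2).
by exists m, n; rewrite xm yn.
Qed.

Lemma parent_ray n : parent (g n) = g n.+1.
Proof.
apply/esym/parent_unique; first exact: ray_edge.
exists n.+1 => m le_nm; rewrite -{1}(subnKC (ltnW le_nm)) -{2}(subnKC le_nm).
by rewrite !ray_g; lia.
Qed.

Lemma busemann_ray n : b (g n) = - n%:Z.
Proof.
have [N dN] := ray_busemannP (g n).
have := dN (n + N)%N; rewrite ray_g leq_addl; lia.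
Qed.

End RayParent.
(** * Ends of trees *)

Section EndRays.
Local Open Scope classical_set_scope.
Variables (T : choiceType) (e : rel T).
Hypothesis tree_e : is_tree e.
Local Notation dist := (gdist e).
Variable g : nat -> T.
Hypothesis ray_g : geodesic_ray e g.
Local Notation par := (parent tree_e ray_g).
Local Notation b := (ray_busemann tree_e ray_g).

(** For a ray, this is equivalence with g in terms of its points in order. *)
Definition merges_with (h : nat -> T) :=
  exists m n, forall k, h (m + k)%N = g (n + k)%N.

Lemma merging_ray_equiv h : merges_with h -> ray_equiv g h.
Proof.
move=> [m [n hg]]; apply: (@sub_finite_set _ _ ((g @` `I_n) `|` (h @` `I_m))).
  move=> x [[[i _ <-] nh]|[[i _ <-] ng]]; [left|right].
    exists i => //=; rewrite ltnNge; apply/negP => le_ni; apply: nh.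
    by exists (m + (i - n))%N => //; rewrite hg subnKC.
  exists i => //=; rewrite ltnNge; apply/negP => le_mi; apply: ng.
  by exists (n + (i - m))%N => //; rewrite -hg subnKC.
by rewrite finite_setU; split; apply: finite_image; exact: finite_II.
Qed.

(** From some index on, h runs through points of g, so each step of h either
    climbs or descends along g; the direction cannot change as h is
    injective. *)
Lemma equiv_ray_merges h : geodesic_ray e h -> ray_equiv g h -> merges_with h.
Proof.
move=> ray_h fin.
have [K onK] : exists K, forall k, (K <= k)%N -> exists a, h k = g a.
  have : finite_set (h @^-1` (range g `+` range h)).
    by apply: finite_preimage fin => i j _ _; exact: (ray_inj tree_e ray_h).
  case/finite_seqP => s Es; exists (\max_(i <- s) i).+1 => k lt_k.
  have [[a _ <-]|nk] := pselect (range g (h k)); first by exists a.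
  have : (h @^-1` (range g `+` range h)) k by right; split=> //; exists k.
  by rewrite Es /= => ks; move: lt_k; rewrite ltnNge leq_bigmax_seq.
(* h cannot descend for ever, since the Busemann function is at most 0 on g. *)
have [k0 le_Kk0 up0] : exists2 k0, (K <= k0)%N & h k0.+1 = par (h k0).
  apply: contrapT => down.
  have bh n : b (h (K + n)%N) = b (h K) + n%:Z.
    elim: n => [|n IHn]; first by rewrite addn0; lia.
    have /(edge_parent tree_e ray_g)[up|hE] := ray_edge tree_e (K + n) ray_h.
      by case: down; exists (K + n)%N; rewrite ?leq_addr.
    have := busemann_parent tree_e ray_g (h (K + n).+1).
    rewrite -hE addnS; lia.
  have [a0 h0] := onK K (leqnn K).
  have [a hE] := onK _ (leq_addr a0.+1 K).
  have := bh a0.+1; rewrite hE h0 !busemann_ray; lia.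
have up k : h (k0 + k).+1 = par (h (k0 + k)%N).
  elim: k => [|k IHk]; first by rewrite addn0.
  have /(edge_parent tree_e ray_g)[//|hE] := ray_edge tree_e (k0 + k).+1 ray_h.
    by rewrite addnS.
  have [a ha] := onK (k0 + k)%N (leq_trans le_Kk0 (leq_addr _ _)).
  have [c hc] : exists c, h (k0 + k).+2 = g c by apply: onK; lia.
  have : g c.+1 = g a.+1 by rewrite -!(parent_ray tree_e ray_g) -ha -hc -IHk -hE.
  move/(ray_inj tree_e ray_g) => [ca].
  have : h (k0 + k).+2 = h (k0 + k)%N by rewrite hc ha ca.
  by move/(ray_inj tree_e ray_h); lia.
have [a ha] := onK k0 le_Kk0; exists k0, a => k.
elim: k => [|k IHk]; first by rewrite !addn0.
by rewrite !addnS up IHk parent_ray.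
Qed.

Lemma merging_ray_climbs h i : geodesic_ray e h -> merges_with h ->
  h i = iter i par (h 0%N).
Proof.
move=> ray_h [m [n hg]]; elim: i => // i IHi; rewrite iterS -IHi.
apply: parent_unique; first exact: (ray_edge tree_e).
exists (n + i.+1)%N => N le_N; have [k Nk] : exists k, N = (n + k)%N.
  by exists (N - n)%N; lia.
rewrite {}Nk -hg in le_N *; have [j jE] : exists j, (m + k = i.+1 + j)%N.
  by exists (m + k - i.+1)%N; lia.
by rewrite jE ray_h addSnnS ray_h.
Qed.

Lemma climb_ray x : geodesic_ray e (fun i => iter i par x).
Proof.
move=> m n; apply/eqP; rewrite eqn_leq; apply/andP; split.
  rewrite addnC iterD; move: (iter m par x) => y.
  elim: n => [|n IHn]; first by rewrite gdistxx.
  apply: leq_trans (gdist_triangle tree_e (iter n par y) _ _) _.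
  by rewrite iterS (gdist_edge tree_e (parent_edge tree_e ray_g _)) addn1.
have := busemann_lipschitz tree_e ray_g (iter m par x) (iter (m + n) par x).
by rewrite !busemann_iter_parent; lia.
Qed.

Lemma climb_merges x : merges_with (fun i => iter i par x).
Proof.
have [N rN] := iter_parent_reaches_ray tree_e ray_g x.
have [m xm] := rN N (leqnn N); exists m, N => k.
elim: k => [|k IHk]; first by rewrite !addn0.
by rewrite !addnS iterS IHk parent_ray.
Qed.

Local Notation w := [set h | geodesic_ray e h /\ ray_equiv g h].

Lemma end_ray_climbs h i : w h -> h i = iter i par (h 0%N).
Proof.
by move=> [ray_h eq_h]; apply: merging_ray_climbs => //; exact: equiv_ray_merges.
Qed.

Lemma climb_in_end x : w (fun i => iter i par x).
Proof.
split; first exact: climb_ray.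
exact/merging_ray_equiv/climb_merges.
Qed.

(** The rays from x and o in the end climb, so they first meet at the first
    common ancestor. *)
Lemma confluentP o x : exists m n,
  [/\ iter m par x = confluent w x o, iter n par o = confluent w x o
    & b x - m%:Z = b o - n%:Z].
Proof.
have heights m n : iter m par x = iter n par o -> b x - m%:Z = b o - n%:Z.
  by move/(congr1 b); rewrite !busemann_iter_parent.
rewrite /confluent; case: xgetP => [z _ [h [k [m [n]]]]|none].
  move=> [[wh h0] [wk k0] [hm kn] _]; exists m, n.
  have hx : iter m par x = z by rewrite -h0 -end_ray_climbs.
  have ko : iter n par o = z by rewrite -k0 -end_ray_climbs.
  by split=> //; apply: heights; rewrite hx ko.
exfalso; have ex : exists m, `[< exists n, iter m par x = iter n par o >].
  have [m [n mn]] := common_ancestor tree_e ray_g x o.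
  by exists m; apply/asboolP; exists n.
case: (ex_minnP ex) => m /asboolP[n mn] min_m.
apply: (none (iter m par x)).
exists (fun i => iter i par x), (fun i => iter i par o), m, n; split=> //.
- by split=> //; exact: climb_in_end.
- by split=> //; exact: climb_in_end.
- move=> i j ij; have le_mi : (m <= i)%N by apply: min_m; apply/asboolP; exists j.
  by split=> //; have := heights _ _ ij; have := heights _ _ mn; lia.
Qed.

Lemma busemann_ray_busemann o x : busemann e w o x = b x - b o.
Proof.
have [m [n [xm on mn]]] := confluentP o x.
rewrite /busemann -{1}xm -on.
have := climb_ray x 0 m; have := climb_ray o 0 n; rewrite /= !add0n => -> ->.
lia.
Qed.

End EndRays.

(** A tree seen from an end: h is the level, and any two vertices have a common
    ancestor. *)
Definition horocyclic (T : choiceType) (e : rel T) (par : T -> T) (h : T -> int) :=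
  [/\ forall x y, e x y <-> y = par x \/ x = par y,
      forall x, h (par x) = h x - 1
    & forall x y, exists m n, iter m par x = iter n par y].

Lemma end_horocyclic (T : choiceType) (e : rel T) (w : set (nat -> T)) (o : T) :
  is_tree e -> is_end e w ->
  busemann e w o o = 0 /\ exists par, horocyclic e par (busemann e w o).
Proof.
move=> tree_e [g ray_g ->]; rewrite !(busemann_ray_busemann tree_e ray_g) subrr.
split=> //; exists (parent tree_e ray_g); split=> [x y|x|x y].
- exact: edge_parent.
- rewrite !(busemann_ray_busemann tree_e ray_g) busemann_parent; lia.
- exact: common_ancestor.
Qed.

Lemma homogeneous_children (T : choiceType) (e : rel T) par h q :
  homogeneous_tree e q -> horocyclic e par h ->
  forall x, exists s : seq T,
    [/\ uniq s, size s = q & forall y, (y \in s) = (par y == x)].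
Proof.
move=> [tree_e deg] [edgeE hpar _] x.
have /card_eq_fsetP : ([set` fset_set [set y | e x y]] #= `I_q.+1)%card.
  by rewrite fset_setK //; exists q.+1.
set E := fset_set _ => card_E.
have memE y : (y \in E) = e x y.
  rewrite in_fset_set; last by exists q.+1.
  by apply/idP/idP => [/set_mem//|exy]; exact/mem_set.
exists (rem (par x) E); split.
- exact: rem_uniq.
- rewrite size_rem ?card_E //; by rewrite memE; apply/edgeE; left.
move=> y; rewrite mem_rem_uniq ?fset_uniq // inE /= memE.
have [->|nyx] /= := eqVneq y (par x).
  apply/esym/eqP => xE; have := hpar (par x); rewrite xE hpar; lia.
apply/idP/eqP => [/edgeE[/eqP|->]//|<-]; first by rewrite (negbTE nyx).
by apply/edgeE; right.
Qed.
(** * Labelling a tree by the cosets of a filtration *)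

Section TwoSidedRay.
Variables (T : choiceType) (par : T -> T) (h : T -> int).
Hypothesis h_par : forall x, h (par x) = h x - 1.

Lemma height_iter_par n x : h (iter n par x) = h x - n%:Z.
Proof. by elim: n => [|n IHn] /=; rewrite ?h_par ?IHn; lia. Qed.

Variable o : T.
Hypothesis h_o : h o = 0.
Hypothesis par_surj : forall x, exists y, par y = x.

(** A choice of a child for every vertex that descends the ancestors of o. *)
Lemma ray_successor : exists next : T -> T, forall x,
  par (next x) = x /\ forall n, x = iter n.+1 par o -> next x = iter n par o.
Proof.
suff /choice[next nextP] : forall x, exists y,
    par y = x /\ forall n, x = iter n.+1 par o -> y = iter n par o.
  by exists next.
move=> x.
have [[n xn]|off] := pselect (exists n, x = iter n.+1 par o).
  exists (iter n par o); rewrite -iterS xn; split=> // k.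
  by move=> /(congr1 h); rewrite !height_iter_par => nk; congr iter; lia.
have [y yx] := par_surj x.
by exists y; split=> [//|n xn]; case: off; exists n.
Qed.

Lemma two_sided_ray : exists ray : int -> T,
  [/\ forall n : nat, ray (- n%:Z) = iter n par o,
      forall m : int, par (ray m) = ray (m - 1)
    & forall m : int, h (ray m) = m].
Proof.
have [next nextP] := ray_successor.
pose ray (m : int) := match m with Posz n => iter n next o
                                 | Negz n => iter n.+1 par o end.
have ray_o (n : nat) : ray (- n%:Z) = iter n par o by case: n.
have par_ray (m : int) : par (ray m) = ray (m - 1).
  case: m => [[|n]|n] //=; first by rewrite (nextP _).1 subn1.
  by rewrite addn0.
exists ray; split=> //; case=> [n|n]; last first.
  by rewrite NegzE ray_o height_iter_par h_o sub0r.
elim: n => [|n IHn]; first by have := ray_o 0%N; rewrite oppr0 => ->.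
have := h_par (ray n.+1); rewrite par_ray.
by rewrite (_ : n.+1%:Z - 1 = n) ?IHn; lia.
Qed.

End TwoSidedRay.

Section ChildLabels.
Variables (T : choiceType) (par : T -> T) (C : zmodType) (cs : seq C).
Hypotheses (uniq_cs : uniq cs) (mem_cs : forall c, c \in cs).
Hypothesis children : forall x, exists s : seq T,
  [/\ uniq s, size s = size cs & forall y, (y \in s) = (par y == x)].
Variable ray : int -> T.
Hypothesis ray_inj : injective ray.
Hypothesis par_ray : forall m : int, par (ray m) = ray (m - 1).

Lemma children_nonempty x : exists y, par y = x.
Proof.
have [[|y s] [_ size_s mem_s]] := children x.
  by have := mem_cs 0; rewrite (size0nil (esym size_s)).
by exists y; apply/eqP; rewrite -mem_s mem_head.
Qed.

(** Labels of the children by C in which 0 always continues the ray. *)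
Lemma child_labelling :
  exists child : T -> C -> T,
  [/\ forall x, injective (child x), forall x c, par (child x c) = x,
      forall y, exists c, child (par y) c = y
    & forall m : int, child (ray (m - 1)) 0 = ray m].
Proof.
suff /choice[child childP] : forall x, exists f : C -> T,
    [/\ injective f, forall c, par (f c) = x,
        forall y, par y = x -> exists c, f c = y
      & forall m, ray m = x -> f 0 = ray (m + 1)].
  exists child; split=> [x|x c|y|m].
  - by case: (childP x).
  - by case: (childP x).
  - by case: (childP (par y)) => _ _ /(_ y erefl).
  - by case: (childP (ray (m - 1))) => _ _ _ /(_ _ erefl); rewrite subrK.
move=> x; have [y0 _] := children_nonempty x.
have [s [us size_s mem_s]] := children x.
pose f c := nth y0 s (index c cs).
have f_inj : injective f.
  move=> c c' /eqP; rewrite nth_uniq ?size_s ?index_mem // => /eqP.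
  by move=> /(congr1 (nth 0 cs)); rewrite !nth_index.
have f_par c : par (f c) = x.
  by apply/eqP; rewrite -mem_s mem_nth // size_s index_mem.
have f_surj y : par y = x -> exists c, f c = y.
  move/eqP; rewrite -mem_s => ys; exists (nth 0 cs (index y s)).
  by rewrite /f index_uniq ?nth_index // -size_s index_mem.
have [c0 f_c0] : exists c0, forall m, ray m = x -> f c0 = ray (m + 1).
  have [[m rm]|off] := pselect (exists m, ray m = x); last first.
    by exists 0 => m rm; case: off; exists m.
  have [|c0 fc0] := f_surj (ray (m + 1)); first by rewrite par_ray addrK.
  exists c0 => n rn; rewrite fc0; congr (ray (_ + 1)).
  by apply: ray_inj; rewrite rm rn.
exists (fun c => f (c + c0)); split=> [c c' /f_inj/addIr//|//|y yx|m rm].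
  by have [c fc] := f_surj y yx; exists (c - c0); rewrite subrK.
by rewrite add0r; exact: f_c0.
Qed.

End ChildLabels.

Section Digits.
Local Open Scope classical_set_scope.
Variable C : zmodType.
Variables (K : zmodType) (A : set K) (B : int -> set K) (res : int -> K -> C).
Hypotheses (A0 : A 0) (A_sub : forall x y, A x -> A y -> A (x - y)).
Hypotheses (B0 : forall m, B m 0).
Hypothesis B_sub : forall (m : int) x y, B m x -> B m y -> B m (x - y).
Hypothesis B_decr : forall (m : int) x, B (m + 1) x -> B m x.
Hypothesis B_exhaust : forall x, A x -> exists m, B m x.
Hypothesis res_sub : forall (m : int) x y, B m x -> B m y ->
  res m (x - y) = res m x - res m y.
Hypothesis res_eq0 : forall (m : int) x, B m x -> (res m x = 0 <-> B (m + 1) x).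
Hypothesis res_surj : forall (m : int) c, exists x, [/\ A x, B m x & res m x = c].

Lemma B_opp m x : B m x -> B m (- x).
Proof. by move=> Bx; rewrite -[- x]sub0r; exact: B_sub. Qed.

Lemma B_add m x y : B m x -> B m y -> B m (x + y).
Proof. by move=> Bx /B_opp By; rewrite -[y]opprK; exact: B_sub. Qed.

Lemma A_add x y : A x -> A y -> A (x + y).
Proof. by move=> Ax Ay; rewrite -[y]opprK -[- y]sub0r; do 2?apply: A_sub. Qed.

Lemma B_decrn (m : int) (n : nat) x : B m x -> B (m - n%:Z) x.
Proof.
move=> Bx; elim: n => [|n IHn]; first by rewrite subr0.
by apply: B_decr; rewrite (_ : _ + 1 = m - n%:Z) //; lia.
Qed.

(** A representative depending only on the coset of x modulo B m, and 0 for B m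
    itself, so that the digit of order m vanishes on B (m + 1). *)
Definition coset_rep m x : K :=
  if pselect (B m x) then 0 else xget 0 [set y | A y /\ B m (x - y)].

Lemma coset_repP m x : A x -> A (coset_rep m x) /\ B m (x - coset_rep m x).
Proof.
move=> Ax; rewrite /coset_rep; case: pselect => [Bx|nBx].
  by rewrite subr0.
by case: xgetP => [y _ //|/(_ x)[]]; rewrite /= subrr.
Qed.

Lemma coset_rep_eq m x y : B m (x - y) -> coset_rep m x = coset_rep m y.
Proof.
move=> Bxy; have transp u v z : B m (u - v) -> B m (u - z) -> B m (v - z).
  by move=> /B_opp Bvu /(B_add Bvu); rewrite opprB addrA subrK.
have Byx : B m (y - x) by rewrite -opprB; exact: B_opp.
rewrite /coset_rep; case: pselect => Bx; case: pselect => By //.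
- by case: By; have := transp x y 0 Bxy; rewrite !subr0; exact.
- by case: Bx; have := transp y x 0 Byx; rewrite !subr0; exact.
congr xget; apply/seteqP; split=> z /= [Az]; first by move/(transp _ _ _ Bxy).
by move/(transp _ _ _ Byx).
Qed.

(** The coefficient of order m in an expansion of x with respect to the
    filtration. *)
Definition digit m x : C := res m (x - coset_rep m x).

Lemma digit_eq0 m x : B (m + 1) x -> digit m x = 0.
Proof.
move=> Bx; have Bmx := B_decr Bx; rewrite /digit /coset_rep.
by case: pselect => [Bm|//]; rewrite subr0; apply/res_eq0.
Qed.

Lemma digit_eq m x y : A x -> A y -> B m (x - y) ->
  digit m x = digit m y <-> B (m + 1) (x - y).
Proof.
move=> Ax Ay Bxy; rewrite -(res_eq0 Bxy) /digit (coset_rep_eq Bxy).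
have Bx := (coset_repP m Ax).2; have By := (coset_repP m Ay).2.
rewrite (coset_rep_eq Bxy) in Bx.
have -> : x - y = (x - coset_rep m y) - (y - coset_rep m y).
  by rewrite opprB addrA subrK.
rewrite (res_sub Bx By); split=> [->|/eqP]; first by rewrite subrr.
by rewrite subr_eq0 => /eqP.
Qed.

Lemma digit_surj m x c : A x ->
  exists y, [/\ A y, B m (x - y) & digit m y = c].
Proof.
move=> Ax; have [z [Az Bz zc]] := res_surj m c.
have [Ar Br] := coset_repP m Ax.
have Bxy : B m (x - (coset_rep m x + z)) by rewrite opprD addrA; exact: B_sub.
exists (coset_rep m x + z); split=> //; first exact: A_add.
by rewrite /digit -(coset_rep_eq Bxy) addrC addKr.
Qed.

End Digits.

Section VertexOfDigits.
Local Open Scope classical_set_scope.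
Variables (T : choiceType) (par : T -> T) (h : T -> int) (o : T).
Hypothesis h_par : forall x, h (par x) = h x - 1.
Hypothesis meet : forall x y, exists m n, iter m par x = iter n par y.
Variable C : zmodType.
Variables (K : zmodType) (A : set K) (B : int -> set K) (res : int -> K -> C).
Hypotheses (A0 : A 0) (A_sub : forall x y, A x -> A y -> A (x - y)).
Hypotheses (B0 : forall m, B m 0).
Hypothesis B_sub : forall (m : int) x y, B m x -> B m y -> B m (x - y).
Hypothesis B_decr : forall (m : int) x, B (m + 1) x -> B m x.
Hypothesis B_exhaust : forall x, A x -> exists m, B m x.
Hypothesis res_sub : forall (m : int) x y, B m x -> B m y ->
  res m (x - y) = res m x - res m y.
Hypothesis res_eq0 : forall (m : int) x, B m x -> (res m x = 0 <-> B (m + 1) x).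
Hypothesis res_surj : forall (m : int) c, exists x, [/\ A x, B m x & res m x = c].

Local Notation digit := (digit A B res).

Variables (ray : int -> T) (child : T -> C -> T).
Hypothesis child_inj : forall x, injective (child x).
Hypothesis par_child : forall x c, par (child x c) = x.
Hypothesis child_par : forall y, exists c, child (par y) c = y.
Hypothesis child_ray : forall m : int, child (ray (m - 1)) 0 = ray m.
Hypothesis h_ray : forall m, h (ray m) = m.
Hypothesis ray_o : forall n : nat, ray (- n%:Z) = iter n par o.

(** Starts on the ray n levels above level m and follows the digits of x. *)
Fixpoint descend (n : nat) (m : int) (x : K) : T :=
  if n is n'.+1 then child (descend n' (m - 1) x) (digit (m - 1) x) else ray m.

(** If x lies in B (m - n), its digits of order below m - n vanish and the
    descent from higher up first follows the ray. *)
Lemma descendS n m x : B (m - n%:Z) x -> descend n.+1 m x = descend n m x.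
Proof.
elim: n m => [|n IHn] m Bx.
  by rewrite subr0 in Bx; rewrite /= digit_eq0 ?child_ray ?subrK.
rewrite -[LHS]/(child (descend n.+1 (m - 1) x) _) IHn //.
by rewrite (_ : m - 1 - _ = m - n.+1%:Z) //; lia.
Qed.

(** The starting level is any one above which x has no digits; when there is
    none the default 0 is taken. *)
Definition vertex m x : T := descend (xget 0%N [set n | B (m - n%:Z) x]) m x.

Lemma vertexE n m x : B (m - n%:Z) x -> vertex m x = descend n m x.
Proof.
have shift i j : B (m - i%:Z) x -> descend (i + j) m x = descend i m x.
  move=> Bi; elim: j => [|j IHj]; first by rewrite addn0.
  rewrite addnS descendS // (_ : _ - _ = m - i%:Z - j%:Z); last by lia.
  exact: B_decrn.
move=> Bn; rewrite /vertex; case: xgetP => [i _ /= Bi|/(_ n)//].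
by rewrite -(shift i n) // addnC shift.
Qed.

Lemma descent_depth (m : int) x : A x -> exists n : nat, B (m - n%:Z) x.
Proof.
move=> /B_exhaust[k Bk]; pose i : int := m - k; pose j : int := (absz i)%:Z - i.
exists (absz i); rewrite (_ : m - _ = k - (absz j)%:Z); last by rewrite /j /i; lia.
exact: B_decrn.
Qed.

Lemma height_vertex (m : int) x : A x -> h (vertex m x) = m.
Proof.
move=> /(descent_depth m)[n /[dup] /vertexE-> _].
elim: n m => [|n IHn] m /=; first exact: h_ray.
have := h_par (child (descend n (m - 1) x) (digit (m - 1) x)).
rewrite par_child IHn. lia.
Qed.

Lemma par_vertex (m : int) x : A x -> par (vertex m x) = vertex (m - 1) x.
Proof.
move=> /(descent_depth (m - 1))[n Bn]; rewrite (vertexE Bn).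
rewrite (@vertexE n.+1) ?par_child //.
by rewrite (_ : _ - _ = m - 1 - n%:Z) //; lia.
Qed.

Lemma vertex_eq (m : int) x y : A x -> A y ->
  vertex m x = vertex m y <-> B m (x - y).
Proof.
move=> Ax Ay.
have [i Bi] := descent_depth m Ax; have [j Bj] := descent_depth m Ay.
have Bx : B (m - (i + j)%N%:Z) x.
  by rewrite (_ : _ - _ = m - i%:Z - j%:Z); [exact: B_decrn | lia].
have By : B (m - (i + j)%N%:Z) y.
  by rewrite (_ : _ - _ = m - j%:Z - i%:Z); [exact: B_decrn | lia].
rewrite (vertexE Bx) (vertexE By); move: (i + j)%N Bx By => n {i j Bi Bj}.
elim: n m => [|n IHn] m Bx By.
  by rewrite subr0 in Bx By; split=> // _; exact: B_sub.
have mn : m - n.+1%:Z = m - 1 - n%:Z by lia.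
rewrite mn in Bx By; have IH := IHn _ Bx By; rewrite /=.
have digitE : B (m - 1) (x - y) ->
    digit (m - 1) x = digit (m - 1) y <-> B m (x - y).
  by move=> Bxy; rewrite -{3}(subrK 1 m); exact: digit_eq.
split=> [E|Bm].
  have E1 : descend n (m - 1) x = descend n (m - 1) y.
    by move/(congr1 par): (E); rewrite !par_child.
  by apply/digitE; [exact/IH | move: E; rewrite E1 => /child_inj].
have Bm1 : B (m - 1) (x - y) by apply: B_decr; rewrite subrK.
by have /IH-> := Bm1; congr child; exact/digitE.
Qed.

Lemma vertex_surj v : exists2 x, A x & vertex (h v) x = v.
Proof.
have [k [n kn]] := meet v o.
elim: k v n kn => [|k IHk] v n kn.
  have vE : v = ray (- n%:Z) by rewrite ray_o.
  exists 0; rewrite // (@vertexE 0) ?subr0; first by rewrite vE h_ray.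
  exact: B0.
have [|x Ax xv] := IHk (par v) n; first by rewrite -iterSr.
have [c cv] := child_par v.
have [y [Ay Bxy yc]] : exists y,
    [/\ A y, B (h (par v)) (x - y) & digit (h (par v)) y = c].
  exact: digit_surj.
exists y; rewrite // -cv.
have [i Bi] := descent_depth (h (par v)) Ay.
have hv : h (child (par v) c) = h (par v) + 1.
  by have := h_par (child (par v) c); rewrite par_child; lia.
rewrite hv (@vertexE i.+1) /= ?addrK ?yc; last first.
  by rewrite (_ : _ - _ = h (par v) - i%:Z) //; lia.
by rewrite -(vertexE Bi) -[in RHS]xv; congr child; apply/esym/vertex_eq.
Qed.

End VertexOfDigits.

(** The tree of cosets x + B m is identified with T: phi m x stands for the
    coset of x modulo B m, at level m. *)
Lemma filtration_labels
    (T : choiceType) (par : T -> T) (h : T -> int) (o : T)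
    (h_par : forall x, h (par x) = h x - 1)
    (meet : forall x y, exists m n, iter m par x = iter n par y)
    (h_o : h o = 0)
    (C : zmodType) (cs : seq C) (uniq_cs : uniq cs) (mem_cs : forall c, c \in cs)
    (children : forall x, exists s : seq T,
      [/\ uniq s, size s = size cs & forall y, (y \in s) = (par y == x)])
    (K : zmodType) (A : set K) (B : int -> set K) (res : int -> K -> C)
    (A0 : A 0) (A_sub : forall x y, A x -> A y -> A (x - y))
    (B0 : forall m, B m 0)
    (B_sub : forall (m : int) x y, B m x -> B m y -> B m (x - y))
    (B_decr : forall (m : int) x, B (m + 1) x -> B m x)
    (B_exhaust : forall x, A x -> exists m, B m x)
    (res_sub : forall (m : int) x y, B m x -> B m y ->
      res m (x - y) = res m x - res m y)
    (res_eq0 : forall (m : int) x, B m x -> (res m x = 0 <-> B (m + 1) x))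
    (res_surj : forall (m : int) c, exists x, [/\ A x, B m x & res m x = c]) :
  exists phi : int -> K -> T,
  [/\ forall (m : int) x, A x -> h (phi m x) = m,
      forall (m : int) x, A x -> par (phi m x) = phi (m - 1) x,
      forall (m : int) x y, A x -> A y -> (phi m x = phi m y <-> B m (x - y))
    & forall v, exists2 x, A x & phi (h v) x = v].
Proof.
have par_surj := children_nonempty mem_cs children.
have [ray [ray_o par_ray h_ray]] := two_sided_ray h_par h_o par_surj.
have [child [child_inj par_child child_par child_ray]] :=
  child_labelling uniq_cs mem_cs children (can_inj h_ray) par_ray.
exists (vertex A B res ray child); split.
- exact: height_vertex.
- exact: par_vertex.
- exact: vertex_eq.
- exact: vertex_surj.
Qed.
(** * Places of a rational function field *)

Section Places.
Variables (F K : fieldType) (iota : {rmorphism {poly F} -> K}).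
Hypothesis iota_inj : injective iota.
Local Notation "p %:K" := (iota p) (at level 2, left associativity, format "p %:K").
Local Notation lin l := ('X + l%:P : {poly F}).

(** At Some l: the functions regular at -l. At None: the functions vanishing at
    infinity, that is, of negative degree. *)
Definition regular_at (p : option F) (x : K) : Prop :=
  exists n d : {poly F},
    [/\ d != 0, if p is Some l then d.[- l] != 0 else (size n < size d)%N
      & x = n%:K / d%:K].

Lemma iota_neq0 (p : {poly F}) : p != 0 -> p%:K != 0.
Proof. by rewrite -(inj_eq iota_inj) rmorph0. Qed.

Lemma lin_neq0 l : lin l != 0.
Proof. by rewrite -size_poly_eq0 size_XaddC. Qed.

Lemma lin_horner l a : (lin l).[- a] = l - a.
Proof. by rewrite hornerD hornerX hornerC addrC. Qed.

Lemma lin_dvd l (p : {poly F}) : p.[- l] = 0 -> exists p', p = p' * lin l.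
Proof.
by move/eqP/factor_theorem => [p' ->]; exists p'; rewrite polyCN opprK.
Qed.

Lemma size_mul_lin l (p : {poly F}) : p != 0 -> size (p * lin l) = (size p).+1.
Proof. by move=> p0; rewrite size_mul ?lin_neq0 // size_XaddC addn2. Qed.

Lemma place_sub p x y : regular_at p x -> regular_at p y -> regular_at p (x - y).
Proof.
move=> [n [d [d0 pd ->]]] [n' [d' [d0' pd' ->]]].
exists (n * d' - n' * d), (d * d'); split; first exact: mulf_neq0.
  case: p pd pd' => [l|] pd pd'; first by rewrite hornerM mulf_neq0.
  have lt_size (u v w : {poly F}) : v != 0 -> (size u < size v)%N -> w != 0 ->
      (size (u * w)%R < size (v * w)%R)%N.
    move=> v0 uv w0; have [->|u0] := eqVneq u 0.
      by rewrite mul0r size_poly0 lt0n size_poly_eq0 mulf_neq0.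
    rewrite !size_mul //; have : (0 < size w)%N by rewrite lt0n size_poly_eq0.
    by move: (size u) (size v) (size w) uv => a b c; lia.
  apply: leq_ltn_trans (size_polyD _ _) _; rewrite size_polyN gtn_max lt_size //.
  by rewrite (mulrC d) lt_size.
rewrite rmorphB !rmorphM /=; field; by rewrite !iota_neq0.
Qed.

Lemma place_mulC p c x : regular_at p x -> regular_at p (c%:P%:K * x).
Proof.
move=> [n [d [d0 pd ->]]]; exists (c *: n), d; split=> //.
  by case: p pd => // lt; apply: leq_ltn_trans (size_scale_leq _ _) lt.
by rewrite -mul_polyC rmorphM mulrA.
Qed.

Lemma place_const l c : regular_at (Some l) c%:P%:K.
Proof.
exists c%:P, 1; rewrite oner_neq0 hornerC oner_neq0; split=> //.
by rewrite rmorph1 divr1.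
Qed.

Lemma finite_place_mul l l' x :
  regular_at (Some l) x -> regular_at (Some l) ((lin l')%:K * x).
Proof.
move=> [n [d [d0 pd ->]]]; exists (lin l' * n), d; split=> //.
by rewrite rmorphM mulrA.
Qed.

Lemma finite_place_div l l' x : l' != l ->
  regular_at (Some l) x -> regular_at (Some l) ((lin l')%:K^-1 * x).
Proof.
move=> ll' [n [d [d0 pd ->]]]; exists n, (d * lin l'); split.
- by rewrite mulf_neq0 ?lin_neq0.
- by rewrite hornerM lin_horner mulf_neq0 // subr_eq0.
- by rewrite rmorphM invfM mulrCA; congr (_ * _); exact: mulrC.
Qed.

Lemma infinite_place_div l x :
  regular_at None x -> regular_at None ((lin l)%:K^-1 * x).
Proof.
move=> [n [d [d0 pd ->]]]; exists n, (d * lin l); split.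
- by rewrite mulf_neq0 ?lin_neq0.
- by rewrite size_mul_lin // ltnW.
- by rewrite rmorphM invfM mulrCA; congr (_ * _); exact: mulrC.
Qed.

Lemma infinite_place_ratio l l' x :
  regular_at None x -> regular_at None ((lin l)%:K / (lin l')%:K * x).
Proof.
move=> [n [d [d0 pd ->]]]; exists (n * lin l), (d * lin l'); split.
- by rewrite mulf_neq0 ?lin_neq0.
- have [->|n0] := eqVneq n 0; last first.
    by rewrite !size_mul_lin ?ltnS //; exact: pd.
  by rewrite mul0r size_poly0 lt0n size_poly_eq0 mulf_neq0 ?lin_neq0.
- rewrite !rmorphM /=; field.
  by rewrite -rmorphD !iota_neq0 ?lin_neq0 ?polyC_eq0.
Qed.

Lemma infinite_place_pole l c : regular_at None (c%:P%:K / (lin l)%:K).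
Proof.
exists c%:P, (lin l); split=> //; first exact: lin_neq0.
by rewrite size_XaddC ltnS size_polyC leq_b1.
Qed.

(** c is the value of x at -l. *)
Lemma finite_residue l x : regular_at (Some l) x ->
  exists c, regular_at (Some l) ((lin l)%:K^-1 * x - c%:P%:K / (lin l)%:K).
Proof.
move=> [n [d [d0 pd ->]]]; exists (n.[- l] / d.[- l]).
have [|n' nE] := @lin_dvd l (n - (n.[- l] / d.[- l])%:P * d).
  by rewrite !hornerE; field.
exists n', d; split=> //; move/(congr1 iota): nE.
rewrite rmorphB !rmorphM /= => nE.
apply: (mulfI (iota_neq0 (lin_neq0 l))).
rewrite mulrA [RHS]mulrA [(lin l)%:K * n'%:K]mulrC -nE.
field.
  by rewrite -rmorphD !iota_neq0 ?lin_neq0 ?polyC_eq0.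
Qed.

Lemma finite_residue_unique l c :
  regular_at (Some l) (c%:P%:K / (lin l)%:K) -> c = 0.
Proof.
move=> [n [d [d0 pd cE]]].
have : c%:P * d = n * lin l.
  apply: iota_inj; rewrite !rmorphM.
  move/eqP: cE; rewrite eqr_div ?iota_neq0 ?lin_neq0 //.
  by move/eqP.
move/(congr1 (fun p => p.[- l])); rewrite !hornerM lin_horner hornerC subrr mulr0.
by move/eqP; rewrite mulf_eq0 (negbTE pd) orbF => /eqP.
Qed.

(** c is the value at infinity of (t + l) x. *)
Lemma infinite_residue l x : regular_at None x ->
  exists c, regular_at None ((lin l)%:K * x - c%:P%:K).
Proof.
move=> [n [d [d0 pd ->]]]; pose s := (size d).-1.
have sd : size d = s.+1 by rewrite prednK // lt0n size_poly_eq0.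
exists ((n * lin l)`_s / d`_s), (n * lin l - ((n * lin l)`_s / d`_s)%:P * d), d.
have ds : d`_s != 0 by rewrite -lead_coefE lead_coef_eq0.
split=> //; last first.
  rewrite rmorphB !rmorphM /=; field.
  by rewrite !iota_neq0 ?polyC_eq0.
rewrite sd ltnS; apply/leq_sizeP => i; rewrite leq_eqVlt => /predU1P[<-|lt_si].
  by rewrite coefB coefCM divfK ?subrr.
have lt_n : (size (n * lin l)%R <= i)%N.
  have [->|n0] := eqVneq n 0; first by rewrite mul0r size_poly0.
  by rewrite size_mul_lin //; apply: leq_trans pd _; rewrite sd.
have di : d`_i = 0 by rewrite nth_default // sd.
by rewrite coefB coefCM di (nth_default _ lt_n) mulr0 subrr.
Qed.

Lemma infinite_residue_unique c : regular_at None c%:P%:K -> c = 0.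
Proof.
move=> [n [d [d0 pd cE]]].
have nE : n = c *: d.
  rewrite -mul_polyC; apply: iota_inj.
  by rewrite rmorphM cE divfK // iota_neq0.
apply/eqP; apply: contraLR pd => c0; by rewrite nE size_scale // ltnn.
Qed.

(** The factors of the denominator cancel one after the other, leaving a
    polynomial of negative degree. *)
Lemma regular_everywhere_eq0 (L : seq F) (p : {poly F}) x :
  x * (\prod_(l <- L) lin l)%:K = p%:K ->
  (forall l, l \in L -> regular_at (Some l) x) -> regular_at None x -> x = 0.
Proof.
elim: L p => [|l L IHL] p.
  rewrite big_nil rmorph1 mulr1 => -> _ [n [d [d0 pd pE]]].
  have nE : n = p * d.
    by apply: iota_inj; rewrite rmorphM pE divfK // iota_neq0.
  have [->|p0] := eqVneq p 0; first by rewrite rmorph0.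
  exfalso; move: pd; rewrite nE size_mul //.
  move: p0 d0; rewrite -!size_poly_gt0 /=.
  by move: (size p) (size d) => a b; lia.
rewrite big_cons => xE regL regoo.
have [n [d [d0 pd xnd]]] := regL l (mem_head _ _).
have [|p' pE] := @lin_dvd l p.
  have : p * d = n * (lin l * \prod_(j <- L) lin j).
    apply: iota_inj; rewrite [LHS]rmorphM [RHS]rmorphM -xE xnd.
    by rewrite mulrAC divfK ?iota_neq0.
  move/(congr1 (fun p => p.[- l])); rewrite !hornerM lin_horner subrr mul0r mulr0.
  by move/eqP; rewrite mulf_eq0 (negbTE pd) orbF => /eqP.
apply: (IHL p') => // [|j jL]; last by apply: regL; rewrite inE jL orbT.
apply: (mulIf (iota_neq0 (lin_neq0 l))); rewrite -rmorphM -pE -xE rmorphM /=.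
by rewrite -mulrA [_%:K * (lin l)%:K]mulrC.
Qed.

End Places.
(** * Places of the product ring *)

Section ProductPlaces.
Variables (r n : nat) (F : 'I_r.+1 -> finFieldType).
Variable ell : forall i : 'I_r.+1, 'I_n.+1 -> F i.
Hypothesis ell_inj : forall i, injective (ell i).

Local Notation Q := (Fqt F).
Local Notation frac i :=
  (@FracField.tofrac {poly F i} : {rmorphism {poly F i} -> {fraction {poly F i}}}).
Local Notation lin := (t_plus_ell ell).

Lemma frac_inj i : injective (frac i).
Proof. by move=> p q /eqP; rewrite tofrac_eq => /eqP. Qed.

Lemma prod_atB (x y : Q) i : prod_at (x - y) i = prod_at x i - prod_at y i.
Proof.
by rewrite /GRing.add /= /prod_add prod_mkE /GRing.opp /= /prod_opp prod_mkE.
Qed.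

Lemma prod_atM (x y : Q) i : prod_at (x * y) i = prod_at x i * prod_at y i.
Proof. exact: prod_mkE. Qed.

Lemma prod_at1 i : prod_at (1 : Q) i = 1.
Proof. exact: prod_mkE. Qed.

Lemma prod_at_constt (c : Fq F) i : prod_at (constt c) i = frac i (prod_at c i)%:P.
Proof. exact: prod_mkE. Qed.

Lemma prod_at_lin j i : prod_at (lin j) i = frac i ('X + (ell i j)%:P).
Proof. by rewrite rmorphD /= -[LHS]/(prod_at (prod_add _ _) i) !prod_mkE. Qed.

Lemma prod_at_linV j i : prod_at (lin j)^-1 i = (frac i ('X + (ell i j)%:P))^-1.
Proof.
apply: (mulIf (iota_neq0 (@frac_inj i) (lin_neq0 (ell i j)))).
rewrite -{1}prod_at_lin -prod_atM mulVr ?t_plus_ell_unit // prod_at1.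
by rewrite mulVf // (iota_neq0 (@frac_inj i)) // lin_neq0.
Qed.

Definition prod_atE :=
  (prod_atB, prod_atM, prod_at1, prod_at_constt, prod_at_linV, prod_at_lin).

(** ord_max is the place at infinity, lift ord_max j the place t = - l_j. *)
Definition place (k : 'I_n.+2) (i : 'I_r.+1) : option (F i) :=
  if unlift ord_max k is Some j then Some (ell i j) else None.

Definition locally_regular (k : 'I_n.+2) (x : Q) : Prop :=
  forall i, regular_at (frac i) (place k i) (prod_at x i).
Local Notation V := locally_regular.

(** A unit of R_d with a simple pole at k; at infinity t itself need not be a
    unit of R_d. *)
Definition pole_unit (k : 'I_n.+2) : Q :=
  if unlift ord_max k is Some j then (lin j)^-1 else lin ord0.
Local Notation u := pole_unit.

(** Multiples of this span the quotient of u_k V_k by V_k, and lie in V_l for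
    all other places l. *)
Definition polar_part (k : 'I_n.+2) : Q :=
  if unlift ord_max k is Some j then (lin j)^-1 else 1.

Lemma pole_unit_unit k : u k \is a GRing.unit.
Proof.
by rewrite /u; case: unliftP => [j _|_]; rewrite ?unitrV t_plus_ell_unit.
Qed.

Lemma place_finite j i : place (lift ord_max j) i = Some (ell i j).
Proof. by rewrite /place liftK. Qed.
Lemma place_infinite i : place ord_max i = None.
Proof. by rewrite /place unlift_none. Qed.
Lemma pole_unit_finite j : u (lift ord_max j) = (lin j)^-1.
Proof. by rewrite /u liftK. Qed.
Lemma pole_unit_infinite : u ord_max = lin ord0.
Proof. by rewrite /u unlift_none. Qed.
Lemma polar_part_finite j : polar_part (lift ord_max j) = (lin j)^-1.
Proof. by rewrite /polar_part liftK. Qed.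
Lemma polar_part_infinite : polar_part ord_max = 1.
Proof. by rewrite /polar_part unlift_none. Qed.

Definition placeE := (place_finite, place_infinite, pole_unit_finite,
  pole_unit_infinite, polar_part_finite, polar_part_infinite).

Lemma local_sub k x y : V k x -> V k y -> V k (x - y).
Proof. by move=> Vx Vy i; rewrite prod_atB; apply: (place_sub (@frac_inj i)). Qed.

Lemma local_mulC k c x : V k x -> V k (constt c * x).
Proof. by move=> Vx i; rewrite !prod_atE; apply: place_mulC. Qed.

Lemma local0 k : V k 0.
Proof.
move=> i; exists 0, 1; rewrite oner_neq0 rmorph0 mul0r; split=> //.
  by case: place => [l|]; rewrite ?hornerC ?oner_neq0 // size_poly0 size_poly1.
exact: prod_mkE.
Qed.

Lemma local_opp k x : V k x -> V k (- x).
Proof. by move=> Vx; rewrite -sub0r; apply: local_sub => //; exact: local0. Qed.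

Lemma local_add k x y : V k x -> V k y -> V k (x + y).
Proof. by move=> Vx /local_opp Vy; rewrite -[y]opprK; exact: local_sub. Qed.

Lemma ell_neq i j j' : lift ord_max j != lift ord_max j' :> 'I_n.+2 ->
  ell i j != ell i j'.
Proof. by rewrite (inj_eq (@ell_inj i)); apply: contraNneq => ->. Qed.

Lemma local_mul_pole_unit k l x : k != l -> V l x -> V l (u k * x).
Proof.
case: (unliftP ord_max k) => [j ->|->]; case: (unliftP ord_max l) => [j' ->|->];
  rewrite ?eqxx // => kl Vx i; have := Vx i; rewrite placeE !(placeE, prod_atE).
- by apply: (finite_place_div); exact: ell_neq.
- exact: (infinite_place_div).
- exact: finite_place_mul.
Qed.

Lemma local_div_pole_unit k x : V k x -> V k ((u k)^-1 * x).
Proof.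
case: (unliftP ord_max k) => [j ->|->] Vx i; have := Vx i;
  rewrite !placeE ?invrK !prod_atE.
- exact: finite_place_mul.
- exact: (infinite_place_div).
Qed.

Lemma local_polar_part k l c : k != l -> V l (constt c * polar_part k).
Proof.
case: (unliftP ord_max k) => [j ->|->]; case: (unliftP ord_max l) => [j' ->|->];
  rewrite ?eqxx // => kl i; rewrite !(placeE, prod_atE).
- rewrite mulrC; apply: (finite_place_div); first exact: ell_neq.
  exact: place_const.
- exact: infinite_place_pole.
- rewrite mulr1; exact: place_const.
Qed.

Lemma polar_part_div_local k c : V k ((u k)^-1 * (constt c * polar_part k)).
Proof.
case: (unliftP ord_max k) => [j ->|->] i; rewrite !placeE ?invrK !prod_atE.
- rewrite mulrCA divff; last by rewrite (iota_neq0 (@frac_inj i)) ?lin_neq0.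
  rewrite mulr1; exact: place_const.
- rewrite mulr1 mulrC; exact: infinite_place_pole.
Qed.

Lemma const_div_local k c : V k ((u k)^-1 * constt c).
Proof.
case: (unliftP ord_max k) => [j ->|->] i; rewrite !placeE ?invrK !prod_atE.
- by apply: finite_place_mul; exact: place_const.
- rewrite mulrC; exact: infinite_place_pole.
Qed.

Lemma local_residue k x : V k x ->
  exists c, V k (u k * x - constt c * polar_part k).
Proof.
move=> Vx; suff res i : exists c, regular_at (frac i) (place k i)
    (prod_at (u k) i * prod_at x i - frac i c%:P * prod_at (polar_part k) i).
  exists (prod_mk (fun i => projT1 (cid (res i)))) => i.
  by rewrite !prod_atE prod_mkE; exact: projT2 (cid (res i)).
have := Vx i; case: (unliftP ord_max k) => [j ->|->]; rewrite !(placeE, prod_atE).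
- by move/(finite_residue (@frac_inj i)).
- move/(infinite_residue (@frac_inj i) (ell i ord0)) => [c rc].
  by exists c; rewrite mulr1.
Qed.

Lemma local_residue_unique k c : V k (constt c * polar_part k) -> c = 0.
Proof.
move=> Vc; apply: prodP => i; rewrite [RHS]prod_mkE; have := Vc i.
case: (unliftP ord_max k) => [j ->|->]; rewrite !(placeE, prod_atE).
- exact: (finite_residue_unique (@frac_inj i)).
- rewrite mulr1; exact: (infinite_residue_unique (@frac_inj i)).
Qed.

Lemma Rd_pole_unit k : Rd ell (u k).
Proof.
case: (unliftP ord_max k) => [j ->|->]; rewrite placeE.
  exact: Rd_t_plus_ellV.
by apply: RdD; [exact: Rd_t | exact: Rd_const].
Qed.

Lemma Rd_pole_unitV k : Rd ell (u k)^-1.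
Proof.
case: (unliftP ord_max k) => [j ->|->]; rewrite placeE ?invrK.
  by apply: RdD; [exact: Rd_t | exact: Rd_const].
exact: Rd_t_plus_ellV.
Qed.

Lemma Rd_polar_part k : Rd ell (polar_part k).
Proof.
case: (unliftP ord_max k) => [j ->|->]; rewrite placeE.
  exact: Rd_t_plus_ellV.
exact: Rd1.
Qed.

(** The indeterminate t is u_k minus a constant for k at infinity. *)
Lemma Rd_generation (P : Q -> Prop) :
  (forall c, P (constt c)) -> (forall x y, P x -> P y -> P (x + y)) ->
  (forall c x, P x -> P (constt c * x)) -> (forall k x, P x -> P (u k * x)) ->
  forall x, Rd ell x -> P x.
Proof.
move=> Pc PD PZ Pu x [p ->].
have Pvar k y : P y -> P (Rd_var ell k * y).
  rewrite /Rd_var; case: unliftP => [j _|_ Py].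
    by have := Pu (lift ord_max j) y; rewrite placeE.
  have -> : tvar F * y = u ord_max * y + constt (- ellq ell ord0) * y.
    by rewrite placeE -mulrDl rmorphN /= addrK.
  by apply: PD; [exact: Pu | exact: PZ].
rewrite /mmap; apply: big_ind => [||m _]; [|exact: PD|apply: PZ].
  by rewrite -(rmorph0 (constt (F := F))); exact: Pc.
rewrite /mmap1; elim/big_rec: _ => [|k y _ Py].
  by rewrite -(rmorph1 (constt (F := F))); exact: Pc.
by elim: (m k) => [|s IHs]; rewrite ?expr0 ?mul1r // exprS -mulrA; exact: Pvar.
Qed.

(** The part of x that is polar at k, found by induction on x. Multiplication by
    u_l can create a pole at l only, a simple one, which is removed by
    subtracting a multiple of the polar part at l. *)
Lemma pole_approximation k x : Rd ell x ->
  exists y, [/\ Rd ell y, V k (y - x) & forall l, l != k -> V l y].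
Proof.
move: x; apply: Rd_generation =>
  [c|x y [x' [Rx' Vx Vx']] [y' [Ry' Vy Vy']]|c x|l x].
- have [->|kmax] := eqVneq k ord_max.
    exists (constt c); split; [exact: Rd_const|by rewrite subrr; exact: local0|].
    move=> l lmax; have := @local_polar_part ord_max l c.
    by rewrite placeE mulr1 eq_sym; exact.
  exists 0; split; [exact: Rd0| |by move=> l _; exact: local0].
  rewrite sub0r -rmorphN; have := @local_polar_part ord_max k (- c).
  by rewrite placeE mulr1 eq_sym; exact.
- exists (x' + y'); split; first exact: RdD.
    by rewrite opprD addrACA; exact: local_add.
  by move=> l lk; apply: local_add; [exact: Vx' | exact: Vy'].
- move=> [x' [Rx' Vx Vx']]; exists (constt c * x'); split.
  + by apply: RdM => //; exact: Rd_const.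
  + by rewrite -mulrBr; exact: local_mulC.
  + by move=> l /Vx'; exact: local_mulC.
move=> [y [Ry Vy Vy']].
have [->|lk] := eqVneq l k.
  have [c Vc] := local_residue Vy.
  exists (u k * y - constt c * polar_part k); split.
  - apply: RdD; first by apply: RdM => //; exact: Rd_pole_unit.
    by apply: RdN; apply: RdM; [exact: Rd_const | exact: Rd_polar_part].
  - by rewrite addrAC -mulrBr.
  - move=> m mk; have km : k != m by rewrite eq_sym.
    apply: local_sub; last exact: local_polar_part.
    by apply: local_mul_pole_unit => //; exact: Vy'.
have [c Vc] := local_residue (Vy' l lk).
exists (u l * y - constt c * polar_part l); split.
- apply: RdD; first by apply: RdM => //; exact: Rd_pole_unit.
  by apply: RdN; apply: RdM; [exact: Rd_const | exact: Rd_polar_part].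
- rewrite addrAC -mulrBr; apply: local_sub; last exact: local_polar_part.
  exact: local_mul_pole_unit.
- move=> m mk; have [->//|ml] := eqVneq m l.
  have lm : l != m by rewrite eq_sym.
  apply: local_sub; last exact: local_polar_part.
  by apply: local_mul_pole_unit => //; exact: Vy'.
Qed.

End ProductPlaces.
(** * The filtrations of R_d and the action of scalings on them *)

Section PlaceFiltration.
Local Open Scope classical_set_scope.
Variables (r n : nat) (F : 'I_r.+1 -> finFieldType).
Variable ell : forall i : 'I_r.+1, 'I_n.+1 -> F i.
Hypothesis ell_inj : forall i, injective (ell i).

Local Notation Q := (Fqt F).
Local Notation frac i :=
  (@FracField.tofrac {poly F i} : {rmorphism {poly F i} -> {fraction {poly F i}}}).
Local Notation lin := (t_plus_ell ell).
Local Notation V := (locally_regular ell).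
Local Notation u := (pole_unit ell).
Local Notation scale kap := (\prod_j lin j ^ kap j).

Lemma clear_denominators x i : Rd ell x -> exists (L : seq 'I_n.+1) p,
  prod_at x i * frac i (\prod_(j <- L) ('X + (ell i j)%:P)) = frac i p.
Proof.
move: x; apply: Rd_generation =>
  [c|x y [L [p xp]] [L' [p' yp]]|c x [L [p xp]]|k x [L [p xp]]].
- by exists [::], (prod_at c i)%:P; rewrite big_nil rmorph1 mulr1 prod_at_constt.
- exists (L ++ L'), (p * \prod_(j <- L') ('X + (ell i j)%:P) +
                     p' * \prod_(j <- L) ('X + (ell i j)%:P)).
  rewrite big_cat [in RHS]rmorphD !rmorphM -xp -yp /=.
  rewrite -[prod_at (x + y) i]/(prod_at (prod_add x y) i) prod_mkE.
  by rewrite mulrDl !mulrA; congr (_ + _); exact: mulrAC.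
- exists L, ((prod_at c i)%:P * p).
  by rewrite prod_atM prod_at_constt -mulrA xp rmorphM.
case: (unliftP ord_max k) => [j ->|->].
  exists (j :: L), p; rewrite placeE prod_atM prod_at_linV big_cons rmorphM -xp.
  rewrite mulrACA mulVf ?mul1r //.
  by rewrite (iota_neq0 (@frac_inj _ F i)) ?lin_neq0.
exists L, (('X + (ell i ord0)%:P) * p).
by rewrite placeE prod_atM prod_at_lin -mulrA xp rmorphM.
Qed.

Lemma Rd_local_eq0 x : Rd ell x -> (forall k, V k x) -> x = 0.
Proof.
move=> Rx Vx; apply: prodP => i; rewrite [RHS]prod_mkE.
have [L [p xp]] := clear_denominators i Rx.
apply: (regular_everywhere_eq0 (@frac_inj _ F i) (L := map (ell i) L) (p := p)).
- by rewrite big_map.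
- by move=> l /mapP[j _ ->]; have := Vx (lift ord_max j) i; rewrite placeE.
- by have := Vx ord_max i; rewrite placeE.
Qed.

Definition place_filtration (k : 'I_n.+2) (m : int) : set Q :=
  [set x | V k (u k ^ m * x)].
Local Notation B := place_filtration.

Definition residue (k : 'I_n.+2) (y : Q) : Fq F :=
  xget 0 [set c | V k (u k * y - constt c * polar_part ell k)].

Lemma residueP k y : V k y ->
  V k (u k * y - constt (residue k y) * polar_part ell k).
Proof.
by move/local_residue => [c Vc]; rewrite /residue; case: xgetP => [_ -> //|/(_ c)].
Qed.

Lemma residue_unique k y c : V k (u k * y - constt c * polar_part ell k) ->
  V k y -> residue k y = c.
Proof.
move=> Vc /residueP Vr; apply/eqP; rewrite -subr_eq0; apply/eqP.
apply: (@local_residue_unique _ _ _ ell k).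
by have := local_sub Vc Vr; rewrite opprB addrC addrA subrK rmorphB mulrBl.
Qed.

Lemma filtration_shift k (m : int) x : u k ^ (m + 1) * x = u k * (u k ^ m * x).
Proof. by rewrite exprzDr ?pole_unit_unit // expr1z mulrA [u k ^ m * _]mulrC. Qed.

Lemma filtration_decr k (m : int) x : B k (m + 1) x -> B k m x.
Proof.
rewrite /B /= filtration_shift => /local_div_pole_unit.
by rewrite mulKr ?pole_unit_unit.
Qed.

Lemma filtration_sub k m x y : B k m x -> B k m y -> B k m (x - y).
Proof. by rewrite /B /= mulrBr; exact: local_sub. Qed.

Lemma filtration0 k m : B k m 0.
Proof. rewrite /B /= mulr0; exact: local0. Qed.

Lemma filtration_decrn k (m : int) (s : nat) x : B k m x -> B k (m - s%:Z) x.
Proof.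
move=> Bx; elim: s => [|s IHs]; first by rewrite subr0.
by apply: filtration_decr; rewrite (_ : _ + 1 = m - s%:Z) //; lia.
Qed.

Lemma filtration_exhaust k x : Rd ell x -> exists m, B k m x.
Proof.
move: x; apply: Rd_generation => [c|x y [m Bx] [m' By]|c x [m Bx]|l x [m Bx]].
- by exists (- 1); rewrite /B /= exprN1; exact: const_div_local.
- exists (m - (absz (m - m')%R)%:Z).
  have {}Bx := filtration_decrn (absz (m - m')%R) Bx.
  have {}By : B k (m - (absz (m - m')%R)%:Z) y.
    rewrite (_ : m - _ = m' - (absz ((absz (m - m')%R)%:Z - (m - m'))%R)%:Z).
      exact: filtration_decrn.
    by lia.
  by rewrite /B /= mulrDr; exact: local_add.
- by exists m; rewrite /B /= mulrCA; exact: local_mulC.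
have [->|lk] := eqVneq l k.
  exists (m - 1); rewrite /B /= mulrA -[X in _ * X * _]expr1z.
  by rewrite -exprzDr ?pole_unit_unit // subrK.
by exists m; rewrite /B /= mulrCA; exact: local_mul_pole_unit.
Qed.

Lemma filtration_residue_sub k m x y : B k m x -> B k m y ->
  residue k (u k ^ m * (x - y)) = residue k (u k ^ m * x) - residue k (u k ^ m * y).
Proof.
move=> Bx By; have Bxy := filtration_sub Bx By.
apply: residue_unique => //.
rewrite rmorphB mulrBl [u k ^ m * (x - y)]mulrBr mulrBr.
have swap (a b c d : Q) : a - b - (c - d) = (a - c) - (b - d).
  by rewrite !opprB addrACA [RHS]addrACA [- b - c]addrC.
by rewrite swap; apply: local_sub; exact: residueP.
Qed.

Lemma filtration_residue_eq0 k (m : int) x : B k m x ->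
  (residue k (u k ^ m * x) = 0 <-> B k (m + 1) x).
Proof.
move=> Bx; have Vr := residueP Bx; rewrite /B /= filtration_shift; split=> [r0|Bx1].
  by move: Vr; rewrite r0 rmorph0 mul0r subr0.
by apply: residue_unique => //; rewrite rmorph0 mul0r subr0.
Qed.

Lemma filtration_residue_surj k (m : int) c :
  exists x, [/\ Rd ell x, B k m x & residue k (u k ^ m * x) = c].
Proof.
have uU := pole_unit_unit ell k.
pose y := (u k)^-1 * (constt c * polar_part ell k).
have uy : u k ^ m * (u k ^ (- m) * y) = y.
  by rewrite mulrA -exprzDr // subrr expr0z mul1r.
exists (u k ^ (- m) * y); split.
- have Ru s : Rd ell (u k ^ s).
    case: s => s; first by apply: RdX; exact: Rd_pole_unit.
    by rewrite NegzE -exprnN -exprVn; apply: RdX; exact: Rd_pole_unitV.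
  apply: RdM => //; apply: RdM; first exact: Rd_pole_unitV.
  by apply: RdM; [exact: Rd_const | exact: Rd_polar_part].
- by rewrite /B /= uy; exact: polar_part_div_local.
rewrite uy; apply: residue_unique; last exact: polar_part_div_local.
by rewrite /y mulrA mulrV // mul1r subrr; exact: local0.
Qed.

(** The filtration is strictly decreasing. *)
Lemma filtration_index k (m m' : int) :
  (forall x, B k m x <-> B k m' x) -> m = m'.
Proof.
suff le m1 m2 : (forall x, B k m1 x -> B k m2 x) -> (m2 <= m1).
  by move=> eqB; apply/eqP; rewrite eq_le !le // => x /eqB.
move=> sub; rewrite leNgt; apply/negP => lt12.
have [x [_ Bx rx]] := filtration_residue_surj k m1 1.
have Bx2 : B k (m1 + 1) x.
  rewrite (_ : m1 + 1 = m2 - (absz (m2 - (m1 + 1))%R)%:Z); last by lia.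
  exact/filtration_decrn/sub.
have /eqP := (filtration_residue_eq0 Bx).2 Bx2.
by rewrite rx oner_eq0.
Qed.

(** The valuation at k of prod_j (t + l_j)^(kap_j). *)
Definition scale_order (kap : 'I_n.+1 -> int) (k : 'I_n.+2) : int :=
  if unlift ord_max k is Some j then kap j else - \sum_j kap j.

(** The quotient of t + l_j by the power of the uniformizer u_k^-1 of its order
    at k. *)
Definition unit_at (k : 'I_n.+2) (j : 'I_n.+1) : Q :=
  if unlift ord_max k is Some j' then if j == j' then 1 else lin j
  else lin j / lin ord0.

Lemma scale_unit_at kap k :
  u k ^ scale_order kap k * scale kap = \prod_j unit_at k j ^ kap j.
Proof.
rewrite /scale_order /unit_at /pole_unit; case: unlift => [j'|]; last first.
  rewrite -sumrN.
  rewrite (big_morph (fun s : int => lin ord0 ^ s) (id1 := 1) (op1 := *%R));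
    first last.
  - by rewrite expr0z.
  - by move=> s s'; rewrite exprzDr ?t_plus_ell_unit.
  rewrite -big_split; apply: eq_bigr => j _ /=.
  rewrite exprMz_comm ?unitrV ?t_plus_ell_unit ?exprz_inv 1?mulrC //.
  exact: mulrC.
rewrite (bigD1 j') //= [RHS](bigD1 j') //= eqxx exp1rz mul1r mulrA.
rewrite exprz_inv -exprzDr ?t_plus_ell_unit // addNr expr0z mul1r.
by apply: eq_bigr => j /negbTE->.
Qed.

Lemma local_mul_unit_at k j x : V k x ->
  V k (unit_at k j * x) /\ V k ((unit_at k j)^-1 * x).
Proof.
rewrite /unit_at; case: (unliftP ord_max k) => [j' ->|->]; last first.
  have ratio j1 j2 y : V ord_max y -> V ord_max (lin j1 / lin j2 * y).
    move=> Vy i; have := Vy i; rewrite !placeE !prod_atE.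
    exact: (infinite_place_ratio (@frac_inj _ F i)).
  move=> Vx; split; first exact: ratio.
  by rewrite invrM ?unitrV ?t_plus_ell_unit // invrK; exact: ratio.
case: eqVneq => [_|jj'] Vx; first by rewrite invr1 mul1r.
have ljj' : lift ord_max j != lift ord_max j' :> 'I_n.+2.
  by rewrite (inj_eq lift_inj).
split; last by rewrite -[_^-1](pole_unit_finite ell); exact: local_mul_pole_unit.
move=> i; have := Vx i; rewrite !placeE !prod_atE; exact: finite_place_mul.
Qed.

Lemma local_mul_unit_atX k j (s : int) x : V k x -> V k (unit_at k j ^ s * x).
Proof.
case: s => s; rewrite ?NegzE -?exprnN -?exprVn -?exprnP => Vx.
  elim: s => [|s IHs]; first by rewrite expr0 mul1r.
  by rewrite exprS -mulrA; exact: (local_mul_unit_at j IHs).1.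
elim: s.+1 => [|{}s IHs]; first by rewrite expr0 mul1r.
by rewrite exprS -mulrA; exact: (local_mul_unit_at j IHs).2.
Qed.

Lemma filtration_scale_sub kap k (m : int) x :
  B k m x -> B k (m + scale_order kap k) (scale kap * x).
Proof.
move=> Bx; rewrite /B /= exprzDr ?pole_unit_unit // mulrA -[_ * _ * scale _]mulrA.
rewrite scale_unit_at -mulrA mulrCA; elim/big_rec: _ => [|j y _ IHy].
  by rewrite mul1r.
by rewrite -mulrA; exact: local_mul_unit_atX.
Qed.

Lemma scale_orderN kap k : scale_order (fun j => - kap j) k = - scale_order kap k.
Proof. by rewrite /scale_order; case: unlift => // ; rewrite sumrN. Qed.

Lemma filtration_scale kap k (m : int) x :
  B k (m + scale_order kap k) (scale kap * x) <-> B k m x.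
Proof.
split; last exact: filtration_scale_sub.
move/(filtration_scale_sub (fun j => - kap j)).
by rewrite scale_orderN addrK mulrA scaleV mul1r.
Qed.

Lemma scale_order_sum kap : \sum_k scale_order kap k = 0.
Proof.
rewrite (bigD1_ord ord_max) //= /scale_order unlift_none.
by under [X in _ + X]eq_bigr do rewrite liftK; rewrite addNr.
Qed.

Lemma scale_order_onto (m : 'I_n.+2 -> int) : \sum_k m k = 0 ->
  scale_order (fun j => m (lift ord_max j)) =1 m.
Proof.
rewrite (bigD1_ord ord_max) //= => /eqP; rewrite addr_eq0 => /eqP m0 k.
by rewrite /scale_order; case: unliftP => [j ->|->] //.
Qed.

(** A scaling determines the shift that it induces on the filtration at each
    place. *)
Lemma scale_order_inj kap kap' : scale kap = scale kap' ->
  scale_order kap =1 scale_order kap'.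
Proof.
move=> eqs k; apply: (@filtration_index k) => x.
rewrite -(mulVKr (scale_unit ell kap) x).
rewrite -{1}[scale_order kap k]add0r filtration_scale eqs.
by rewrite -[scale_order kap' k]add0r filtration_scale.
Qed.

(** The polar parts of y_k at k, for all k, add up to x. *)
Lemma strong_approximation (y : 'I_n.+2 -> Q) : (forall k, Rd ell (y k)) ->
  exists2 x, Rd ell x & forall k, V k (x - y k).
Proof.
move=> Ry; pose z k := projT1 (cid (pole_approximation ell_inj k (Ry k))).
have zP k : [/\ Rd ell (z k), V k (z k - y k) & forall l, l != k -> V l (z k)].
  exact: projT2 (cid (pole_approximation ell_inj k (Ry k))).
exists (\sum_k z k).
  by apply: (big_ind (Rd ell)) => [||k _]; [exact: Rd0|exact: RdD|case: (zP k)].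
move=> k; rewrite (bigD1 k) //= addrAC; apply: local_add; first by case: (zP k).
apply: (big_ind (V k)) => [|x x'|l lk]; [exact: local0|exact: local_add|].
by case: (zP l) => _ _; apply; rewrite eq_sym.
Qed.

Lemma Fq_enumeration : exists cs : seq (Fq F),
  [/\ uniq cs, size cs = \prod_i #|F i|%N & forall c, c \in cs].
Proof.
exists (enum {: {dffun forall i, F i}}); split.
- exact: enum_uniq.
- by rewrite -cardE card_dep_ffun foldrE big_map big_enum.
- by move=> c; exact: mem_enum.
Qed.

End PlaceFiltration.
(** * The affine group and its generators *)

Section AffineCoordinates.
Local Open Scope classical_set_scope.
Variables (r n : nat) (F : 'I_r.+1 -> finFieldType).
Variable ell : forall i : 'I_r.+1, 'I_n.+1 -> F i.
Hypothesis ell_inj : forall i, injective (ell i).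

Local Notation Q := (Fqt F).
Local Notation G := (Gamma ell).
Local Notation lin := (t_plus_ell ell).
Local Notation V := (locally_regular ell).
Local Notation B := (place_filtration ell).
Local Notation u := (pole_unit ell).
Local Notation scale kap := (\prod_j lin j ^ kap j).

Lemma affine_mx_inj (a b a' b' : Q) :
  affine_mx a b = affine_mx a' b' -> a = a' /\ b = b'.
Proof.
case/eq_block_mx => /matrixP/(_ 0 0) + /matrixP/(_ 0 0) + _ _.
by rewrite !mxE.
Qed.

Lemma Gamma_coordinates (g : G) : exists c : ('I_n.+1 -> int) * Q,
  Rd ell c.2 /\ val g = affine_mx (scale c.1) c.2.
Proof. by have [k [P RP gE]] := asboolW (valP g); exists (k, P). Qed.

Definition coords (g : G) := projT1 (cid (Gamma_coordinates g)).
Definition translation (g : G) : Q := (coords g).2.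
Definition height (g : G) (k : 'I_n.+2) : int := scale_order (coords g).1 k.

Lemma Rd_translation g : Rd ell (translation g).
Proof. exact: (projT2 (cid (Gamma_coordinates g))).1. Qed.

Lemma coordsE g : val g = affine_mx (scale (coords g).1) (translation g).
Proof. exact: (projT2 (cid (Gamma_coordinates g))).2. Qed.

Lemma coords_of_mx g kap P : val g = affine_mx (scale kap) P ->
  height g =1 scale_order kap /\ translation g = P.
Proof.
rewrite coordsE => /affine_mx_inj[sE ->]; split=> // k.
exact: scale_order_inj sE k.
Qed.

Lemma Gamma_of_coords kap P : Rd ell P ->
  exists g : G, val g = affine_mx (scale kap) P.
Proof.
move=> RP; have gP : is_Gamma ell (affine_mx (scale kap) P) by exists kap, P.
by exists (exist (fun A => `[< is_Gamma ell A >]) _ (asboolT gP)).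
Qed.

Lemma Gamma_ext g g' : height g =1 height g' -> translation g = translation g' ->
  g = g'.
Proof.
move=> hE tE; apply: val_inj; rewrite !coordsE tE; congr affine_mx.
apply: eq_bigr => j _; congr (_ ^ _).
by have := hE (lift ord_max j); rewrite /height /scale_order liftK.
Qed.

Lemma height_sum g : \sum_k height g k = 0.
Proof. exact: scale_order_sum. Qed.

Lemma coords_mul g g' :
  height (g * g')%g =1 (fun k => height g k + height g' k) /\
  translation (g * g')%g = scale (coords g).1 * translation g' + translation g.
Proof.
have mE : val (g * g')%g = affine_mx
    (scale (fun j => (coords g).1 j + (coords g').1 j))
    (scale (coords g).1 * translation g' + translation g).
  by rewrite -[LHS]/(val g *m val g') !coordsE affine_mxM scaleD.
have [hE tE] := coords_of_mx mE; split=> // k; rewrite hE /height /scale_order.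
by case: unlift => //; rewrite big_split opprD.
Qed.

Lemma coords_div x y :
  (forall k, height (x^-1 * y)%g k = height y k - height x k) /\
  translation y - translation x = scale (coords x).1 * translation (x^-1 * y)%g.
Proof.
have [hE tE] := coords_mul x (x^-1 * y)%g; rewrite mulVKg in hE tE.
by split=> [k|]; rewrite ?hE ?tE ?addrK // addrC addKr.
Qed.

(** The neighbours of the identity: the level rises by 1 at i, drops by 1 at j,
    and the cosets agree up to the lower of the two levels at each place. *)
Definition is_step (z : G) := exists i j : 'I_n.+2, i != j /\
  forall k, height z k = (k == i)%:Z - (k == j)%:Z /\
            B k (- (k == j)%:Z) (translation z).

Lemma step_div x y : is_step (x^-1 * y)%g <-> exists i j : 'I_n.+2, i != j /\
  forall k, height y k - height x k = (k == i)%:Z - (k == j)%:Z /\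
            B k (height x k - (k == j)%:Z) (translation y - translation x).
Proof.
have [hE tE] := coords_div x y.
have BE k j : B k (height x k - (k == j)%:Z) (translation y - translation x) <->
    B k (- (k == j)%:Z) (translation (x^-1 * y)%g).
  by rewrite tE addrC; exact: filtration_scale.
by split=> -[i [j [ij zP]]]; exists i, j; split=> // k; have [hk Bk] := zP k;
  (split; [by rewrite -hk hE | exact/BE]).
Qed.

(** For fixed i and j the translation lies in u_j V_j and in V_k for all other
    k; so it is a multiple of the polar part at j. *)
Lemma finite_steps : finite_set [set z | is_step z].
Proof.
pose param (t : 'I_n.+2 * 'I_n.+2 * {dffun forall i, F i}) : G :=
  xget 1%g [set z | (forall k, height z k = (k == t.1.1)%:Z - (k == t.1.2)%:Z) /\
                    translation z = constt (t.2 : Fq F) * polar_part ell t.1.2].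
apply: (@sub_finite_set _ _ (range param)); last exact/finite_image/finite_finset.
move=> z [i [j [ij zP]]].
have [c Vc] : exists c, V j (translation z - constt c * polar_part ell j).
  have [_] := zP j; rewrite eqxx => /local_residue[c].
  by rewrite mulrA exprN1 mulrV ?pole_unit_unit // mul1r => Vc; exists c.
have tE : translation z = constt c * polar_part ell j.
  apply/eqP; rewrite -subr_eq0; apply/eqP/(Rd_local_eq0 (ell := ell)) => [|k].
    apply: RdD; first exact: Rd_translation.
    by apply: RdN; apply: RdM; [exact: Rd_const | exact: Rd_polar_part].
  have [->//|kj] := eqVneq k j; apply: local_sub.
    by have [_] := zP k; rewrite (negbTE kj) /place_filtration /= mul1r.
  by apply: local_polar_part => //; rewrite eq_sym.
exists (i, j, (c : {dffun forall i, F i})) => //; rewrite /param.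
case: xgetP => [y _ [hy ty]|/(_ z)[]]; last by split=> // k; case: (zP k).
by apply: Gamma_ext => [k|]; rewrite ?hy ?ty //=; case: (zP k).
Qed.

Section Generation.
Variable H : {pred G}.
Hypotheses (group_H : group_closed H) (steps_H : forall z, is_step z -> z \in H).

Definition attained (a b : Q) := exists2 g, g \in H & val g = affine_mx a b.

Lemma attained_mul a b a' b' : attained a b -> attained a' b' ->
  attained (a * a') (a * b' + b).
Proof.
move=> [g Hg gE] [g' Hg' gE']; exists (g * g')%g.
  case: group_H => H1 HV; have Hi : (g'^-1)%g \in H by rewrite -[_^-1%g]mul1g HV.
  by rewrite -[g']invgK HV.
by rewrite -[LHS]/(val g *m val g') gE gE' affine_mxM.
Qed.

Lemma attained_inv a b a' : a' * a = 1 -> attained a b -> attained a' (- (a' * b)).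
Proof.
move=> a'a [g Hg gE]; exists (g^-1)%g.
  by case: group_H => H1 HV; rewrite -[_^-1%g]mul1g HV.
rewrite -[LHS]mul1mx -affine_mx1 -a'a.
have -> : affine_mx (a' * a) 0 = affine_mx a' (- (a' * b)) *m val g.
  by rewrite gE affine_mxM subrr.
rewrite -mulmxA -[val g *m _]/(val (g * g^-1)%g) mulgV.
exact: mulmx1.
Qed.

(** These steps rise at the place of l_j and drop at infinity. *)
Lemma attained_lin j c : attained (lin j) (constt c).
Proof.
have [g gE] := Gamma_of_coords (fun i => (i == j)%:Z) (Rd_const ell c).
have sE : scale (fun i => (i == j)%:Z) = lin j.
  rewrite (bigD1 j) //= eqxx expr1z big1 ?mulr1 // => i /negbTE->.
  exact: expr0z.
exists g; last by rewrite -sE.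
apply: steps_H; have [hg tg] := coords_of_mx gE.
exists (lift ord_max j), ord_max; split; first by rewrite eq_sym neq_lift.
move=> k; rewrite hg tg /scale_order; case: (unliftP ord_max k) => [i ->|->].
  rewrite (inj_eq lift_inj) [_ == ord_max]eq_sym (negbTE (neq_lift _ _)) subr0.
  split=> //.
  rewrite /place_filtration /= mul1r.
  have := @local_polar_part _ _ _ ell ell_inj ord_max (lift ord_max i) c.
  by rewrite placeE mulr1; apply; exact: neq_lift.
rewrite (negbTE (neq_lift _ _)) eqxx sub0r; split.
  by rewrite (bigD1 j) //= eqxx big1 // => i /negbTE->.
rewrite /place_filtration /= exprN1; exact: const_div_local.
Qed.

Lemma attained_const c : attained 1 (constt c).
Proof.
have invl : (lin ord0)^-1 * lin ord0 = 1 by rewrite mulVr ?t_plus_ell_unit.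
have := attained_mul (attained_lin ord0 c)
  (attained_inv invl (attained_lin ord0 0)).
by rewrite mulrV ?t_plus_ell_unit // rmorph0 !mulr0 oppr0 mulr0 add0r.
Qed.

(** Conjugation by a scaling. *)
Lemma attained_conj a b : attained a 0 -> a \is a GRing.unit -> attained 1 b ->
  attained 1 (a * b) /\ attained 1 (a^-1 * b).
Proof.
move=> Ha ua Hb; have Hai := attained_inv (mulVr ua) Ha.
rewrite mulr0 oppr0 in Hai; split.
  have := attained_mul (attained_mul Ha Hb) Hai.
  by rewrite mulr1 divrr // mulr0 add0r addr0.
have := attained_mul (attained_mul Hai Hb) Ha.
by rewrite mulr1 mulVr // mulr0 add0r addr0.
Qed.

Lemma attained_translation b : Rd ell b -> attained 1 b.
Proof.
move=> Rb; suff: forall c, attained 1 (constt c * b).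
  by move/(_ 1); rewrite rmorph1 mul1r.
move: b Rb; apply: Rd_generation => [c c'|x y Hx Hy c|c x Hx c'|k x Hx c].
- by rewrite -rmorphM; exact: attained_const.
- by have := attained_mul (Hy c) (Hx c); rewrite !mul1r -mulrDr.
- by rewrite mulrA -rmorphM; exact: Hx.
have Hl j : attained (lin j) 0.
  by rewrite -(rmorph0 (constt (F := F))); exact: attained_lin.
rewrite mulrCA; case: (unliftP ord_max k) => [j ->|->]; rewrite placeE.
  by have [] := attained_conj (Hl j) (t_plus_ell_unit ell j) (Hx c).
by have [] := attained_conj (Hl ord0) (t_plus_ell_unit ell ord0) (Hx c).
Qed.

Lemma attained_scale kap : attained (scale kap) 0.
Proof.
have Hmul0 a a' : attained a 0 -> attained a' 0 -> attained (a * a') 0.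
  by move=> Ha Ha'; have := attained_mul Ha Ha'; rewrite mulr0 addr0.
have H1 : attained 1 0 by apply: attained_translation; exact: Rd0.
have Hl j : attained (lin j) 0.
  by rewrite -(rmorph0 (constt (F := F))); exact: attained_lin.
have Hli j : attained (lin j)^-1 0.
  have := attained_inv (mulVr (t_plus_ell_unit ell j)) (Hl j).
  by rewrite mulr0 oppr0.
apply: (big_ind (fun a => attained a 0)) => // j _.
case: (kap j) => s; rewrite ?NegzE -?exprnN -?exprVn -?exprnP.
  by elim: s => [|s IHs]; rewrite ?expr0 // exprS; exact: Hmul0.
by elim: s.+1 => [|{}s IHs]; rewrite ?expr0 // exprS; exact: Hmul0.
Qed.

Lemma steps_generate g : g \in H.
Proof.
have := attained_mul (attained_translation (Rd_translation g))
  (attained_scale (coords g).1).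
rewrite !mul1r add0r => -[g' Hg' gE'].
by have <- : g' = g by apply: val_inj; rewrite gE' coordsE.
Qed.

End Generation.
End AffineCoordinates.
(** * The group as the vertex set of the horocyclic product *)

Lemma DL_adj_sym (T : choiceType) (e : rel T) d w o (x y : @DL_vertex T e d w o) :
  symmetric e -> DL_adj x y -> DL_adj y x.
Proof.
move=> sym_e [i [j [ij ei ej same]]]; exists i, j.
by split=> [||//|k ki kj]; rewrite 1?sym_e // same.
Qed.

Section Realization.
Local Open Scope classical_set_scope.
Variables (r n : nat) (F : 'I_r.+1 -> finFieldType).
Variable ell : forall i : 'I_r.+1, 'I_n.+1 -> F i.
Hypothesis ell_inj : forall i, injective (ell i).
Variables (T : choiceType) (e : rel T) (o : T) (w : set (nat -> T)).
Variable par : T -> T.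
Local Notation h := (busemann e w o).
Hypothesis horo : horocyclic e par h.

Local Notation Q := (Fqt F).
Local Notation G := (Gamma ell).
Local Notation R := (Rd ell).
Local Notation B := (place_filtration ell).

Variable phi : 'I_n.+2 -> int -> Q -> T.
Hypothesis h_phi : forall k (m : int) x, R x -> h (phi k m x) = m.
Hypothesis par_phi : forall k (m : int) x, R x -> par (phi k m x) = phi k (m - 1) x.
Hypothesis phi_eq : forall k (m : int) x y, R x -> R y ->
  (phi k m x = phi k m y <-> B k m (x - y)).
Hypothesis phi_surj : forall k v, exists2 x, R x & phi k (h v) x = v.

(** phi k m x is the vertex of the k-th tree for the coset of x modulo B k m. *)
Definition tree_coords (g : G) : {ffun 'I_n.+2 -> T} :=
  [ffun k => phi k (height g k) (translation g)].

Lemma h_tree_coords g k : h (tree_coords g k) = height g k.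
Proof. by rewrite ffunE h_phi //; exact: Rd_translation. Qed.

Fact tree_coords_DL g : \sum_(k < n.+2) h (tree_coords g k) == 0.
Proof. by rewrite (eq_bigr _ (fun k _ => h_tree_coords g k)) height_sum. Qed.

Definition realize (g : G) : DL_vertex e n.+2 w o :=
  exist (fun x : {ffun 'I_n.+2 -> T} => \sum_(k < n.+2) h (x k) == 0)
    _ (tree_coords_DL g).

Lemma tree_coords_eqP x y k : tree_coords x k = tree_coords y k <->
  height x k = height y k /\ B k (height x k) (translation y - translation x).
Proof.
have Rx := Rd_translation x; have Ry := Rd_translation y.
split=> [E|[hE BE]].
  have hE : height x k = height y k by rewrite -!h_tree_coords E.
  by split=> //; move/esym: E; rewrite !ffunE -hE phi_eq.
by apply/esym; rewrite !ffunE -hE phi_eq.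
Qed.

Lemma tree_coords_parP x y k : tree_coords x k = par (tree_coords y k) <->
  height y k - height x k = 1 /\ B k (height x k) (translation y - translation x).
Proof.
have Rx := Rd_translation x; have Ry := Rd_translation y.
have [_ hpar _] := horo.
split=> [E|[hE BE]].
  have hE : height x k = height y k - 1 by rewrite -!h_tree_coords E hpar.
  split; first by rewrite hE; lia.
  by move/esym: E; rewrite !ffunE par_phi // -hE phi_eq.
have hE' : height x k = height y k - 1 by lia.
by apply/esym; rewrite !ffunE par_phi // -hE' phi_eq.
Qed.

(** The quotient of two elements with the same image is a translation by an
    element that lies in V_k for all k. *)
Lemma realize_inj : injective realize.
Proof.
move=> x y /(congr1 val)/ffunP/= E.
have coordE k := (tree_coords_eqP x y k).1 (E k).
apply: Gamma_ext => [k|]; first by case: (coordE k).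
have [_ tE] := coords_div ell_inj x y.
apply/esym/eqP; rewrite -subr_eq0 tE; apply/eqP.
rewrite (Rd_local_eq0 (ell := ell) (x := translation (x^-1 * y)%g)) ?mulr0 //.
  exact: Rd_translation.
move=> k; have [_] := coordE k.
rewrite tE -{1}[height x k]add0r => /filtration_scale.
by rewrite /place_filtration /= mul1r; exact.
Qed.

(** After scaling to level 0 at every place, this is strong approximation. *)
Lemma realize_surj v : exists g, realize g = v.
Proof.
pose m k := h (val v k); have m0 : \sum_k m k = 0 by apply/eqP; exact: valP v.
have ordE := scale_order_onto m0; set kap := fun j => _ in ordE.
pose y k := projT1 (cid2 (phi_surj k (val v k))).
have yP k : R (y k) /\ phi k (m k) (y k) = val v k.
  by rewrite /y; case: cid2.
pose z k := \prod_j t_plus_ell ell j ^ (- kap j) * y k.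
have [k|x Rx Vx] := strong_approximation ell_inj (y := z).
  by apply: RdM; [exact: Rd_scale | case: (yP k)].
pose P := \prod_j t_plus_ell ell j ^ kap j * x.
have RP : R P by apply: RdM => //; exact: Rd_scale.
have [g /(coords_of_mx ell_inj)[hg tg]] := Gamma_of_coords kap RP.
exists g; apply: val_inj; apply/ffunP => k /=.
rewrite ffunE hg tg ordE -(yP k).2; apply/phi_eq => //; first by case: (yP k).
have -> : P - y k = \prod_j t_plus_ell ell j ^ kap j * (x - z k).
  by rewrite /P mulrBr /z mulrA [_ * \prod_j _ ^ (- _)]mulrC scaleV mul1r.
rewrite -ordE -[scale_order _ _]add0r; apply/filtration_scale => //.
by rewrite /place_filtration /= mul1r.
Qed.

Lemma realize_bij : bijective realize.
Proof.
have /choice[inv invK] := realize_surj.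
by exists inv => // g; apply: realize_inj; rewrite invK.
Qed.

Lemma realize_adj x y : DL_adj (realize x) (realize y) <-> is_step (x^-1 * y)%g.
Proof.
rewrite step_div //; have [edgeE hpar _] := horo.
have Bsym k m a b : B k m (a - b) -> B k m (b - a).
  by rewrite -(opprB a b) /place_filtration /= mulrN; exact: local_opp.
split=> [[i [j [ij /edgeE ei /edgeE ej same]]]|[i [j [ij step]]]]; last first.
  have ji : j != i by rewrite eq_sym.
  exists i, j; split=> [//|||k ki kj].
  - apply/edgeE; right; apply/tree_coords_parP; have := step i.
    by rewrite eqxx (negbTE ij) !subr0.
  - apply/edgeE; left; apply/tree_coords_parP; have [hj Bj] := step j.
    rewrite eqxx (negbTE ji) in hj Bj; have hE : height y j = height x j - 1 by lia.
    by rewrite hE; split; [lia | exact: Bsym].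
  - apply/tree_coords_eqP; have := step k.
    rewrite (negbTE ki) (negbTE kj) !subr0 => -[hk Bk].
    by split=> //; lia.
have same_h k : k != i -> k != j -> height y k = height x k.
  by move=> ki kj; rewrite -!h_tree_coords -[tree_coords x]/(val (realize x)) same.
(* Only the components i and j move, so one of them rises and the other drops. *)
have sum0 : (height y i - height x i) + (height y j - height x j) = 0.
  have : \sum_k (height y k - height x k) = 0 by rewrite sumrB !height_sum subrr.
  rewrite (bigD1 i) //= (bigD1 j) /=; last by rewrite eq_sym.
  by rewrite big1 ?addr0 // => k /andP[ki kj]; rewrite same_h // subrr.
have up_down a b : a != b -> (forall k, k != a -> k != b ->
      tree_coords x k = tree_coords y k) ->
    tree_coords x a = par (tree_coords y a) ->
    tree_coords y b = par (tree_coords x b) ->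
    forall k, height y k - height x k = (k == a)%:Z - (k == b)%:Z /\
      B k (height x k - (k == b)%:Z) (translation y - translation x).
  move=> ab rest /tree_coords_parP[ha Ba] /tree_coords_parP[hb Bb] k.
  have [->|ka] := eqVneq k a; first by rewrite (negbTE ab) !subr0.
  have [->|kb] := eqVneq k b.
    rewrite sub0r (_ : _ - 1%:Z = height y b); last by lia.
    by split; [lia | exact: Bsym].
  have /tree_coords_eqP[hk Bk] := rest k ka kb.
  by rewrite !subr0 hk subrr -hk.
have ji : j != i by rewrite eq_sym.
case: ei ej => [yi|xi] [yj|xj].
- have [hi _] := (tree_coords_parP _ _ _).1 yi.
  have [hj _] := (tree_coords_parP _ _ _).1 yj; lia.
- exists j, i; split=> //; apply: up_down => // k kj ki; exact: same.
- exists i, j; split=> //; apply: up_down => // k ki kj; exact: same.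
- have [hi _] := (tree_coords_parP _ _ _).1 xi.
  have [hj _] := (tree_coords_parP _ _ _).1 xj; lia.
Qed.

End Realization.

Theorem mainTheorem6
    (d q : nat) (hd : (2 <= d)%N) (hq : (2 <= q)%N)
    (r : nat) (b a p : 'I_r.+1 -> nat)
    (hb : forall i, prime (b i)) (hb_inj : injective b)
    (ha : forall i, (0 < a i)%N)
    (hp : forall i, p i = (b i ^ a i)%N)
    (hfact : q = (\prod_(i < r.+1) p i)%N)
    (hpd : forall i, (d.-1 <= p i)%N)
    (F : 'I_r.+1 -> finFieldType) (hF : forall i, #|F i| = p i)
    (ell : forall i : 'I_r.+1, 'I_d.-1 -> F i)
    (hell : forall i, injective (ell i))
    (T : choiceType) (e : rel T) (hT : homogeneous_tree e q)
    (o : T) (w : set (nat -> T)) (hw : is_end e w) :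
  is_Cayley_graph (@DL_adj T e d w o) (Gamma ell).
Proof.
case: d hd hpd ell hell => [|[|n]] // _ _ ell ell_inj.
have [tree_e _] := hT; have sym_e := tree_sym tree_e.
have [h_o [par horo]] := end_horocyclic o tree_e hw.
have [edgeE h_par meet] := horo.
have [cs [uniq_cs size_cs mem_cs]] := Fq_enumeration F.
have children : forall x, exists s : seq T,
    [/\ uniq s, size s = size cs & forall y, (y \in s) = (par y == x)].
  rewrite size_cs (eq_bigr _ (fun i _ => hF i)) -hfact.
  exact: homogeneous_children hT horo.
have labels (k : 'I_n.+2) := filtration_labels
  h_par meet h_o uniq_cs mem_cs children (Rd0 ell) (fun x y Rx Ry => RdD Rx (RdN Ry))
  (filtration0 ell k) (@filtration_sub _ _ _ ell k) (@filtration_decr _ _ _ ell k)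
  (@filtration_exhaust _ _ _ ell ell_inj k) (@filtration_residue_sub _ _ _ ell k)
  (@filtration_residue_eq0 _ _ _ ell k) (@filtration_residue_surj _ _ _ ell k).
pose phi k := projT1 (cid (labels k)).
have phiP k := projT2 (cid (labels k)).
have h_phi k := let: And4 H _ _ _ := phiP k in H.
have par_phi k := let: And4 _ H _ _ := phiP k in H.
have phi_eq k := let: And4 _ _ H _ := phiP k in H.
have phi_surj k := let: And4 _ _ _ H := phiP k in H.
pose f := realize (phi := phi) h_phi.
have adjE x y : DL_adj (f x) (f y) <-> is_step (x^-1 * y)%g.
  exact: realize_adj.
have fin := finite_steps ell_inj.
have in_S (z : Gamma ell) :
    (z \in fset_set [set z : Gamma ell | is_step z]) = `[< is_step z >].
  by rewrite in_fset_set.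
have step_inv (z : Gamma ell) : is_step z -> is_step (z^-1)%g.
  have := adjE 1%g z; have := adjE z 1%g; rewrite invg1 mul1g mulg1 => E1 E2.
  by move/E2/(DL_adj_sym sym_e)/E1.
exists (fset_set [set z : Gamma ell | is_step z]); split.
- move=> z; rewrite !in_S; apply/asboolP/asboolP => /step_inv //.
  by rewrite invgK.
- move=> H group_H sub_H x; apply: steps_generate => // z step_z.
  by apply: sub_H; rewrite in_S; apply/asboolP.
exists f; first exact: realize_bij.
by move=> x y; rewrite in_S adjE; split => /asboolP.
Qed.
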